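(* Let $u\in\mathcal{C}_{ad}$ be a feasible point for the reduced problem (minimize $\mathcal{J}$ over $\mathcal{C}_{ad}$) which is not $B$-stationary. Then there exists $\epsilon^*>0$ such that for $0<\epsilon<\epsilon^*$ a solution $h_\epsilon$ of the problem $$\text{minimize}\quad \tfrac12 q(h,h)+\langle S(u)-g,d_\epsilon\rangle+\alpha\langle u,h\rangle\quad\text{over } h\in L^2(\Omega),\ d_\epsilon\in H_0^1(\Omega),$$ $$\text{subject to}\quad -\Delta d_\epsilon+D_\epsilon(y;d_\epsilon)=h\ \text{in }\Omega,\quad d_\epsilon=0\ \text{on }\partial\Omega,\quad h\in T_{\mathcal{C}_{ad}}(u),$$ where $y=S(u)$, is a descent direction for $\mathcal{J}$ at $u$, i.e. $\mathcal{J}'(u;h_\epsilon)<0$ (in particular $h_\epsilon\neq0$).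
   Context: Setting. $\Omega\subset\mathbb{R}^m$, $m\ge2$, is an open bounded Lipschitz domain; $g\in L^2(\Omega)$, $\alpha>0$; $p\ge2$, $p>m/2$; $\langle\cdot,\cdot\rangle$ is the $L^2(\Omega)$ inner product. $\mathcal{C}_{ad}=\{u\in L^p(\Omega): u_a\le u\le u_b \text{ a.e. in }\Omega\}$ with $u_a,u_b\in L^\infty(\Omega)$, $u_a<u_b$ a.e. Its contingent cone at $u\in\mathcal{C}_{ad}$ is $T_{\mathcal{C}_{ad}}(u)=\{h\in L^p(\Omega): h\ge0\text{ a.e. on }\{u=u_a\},\ h\le0\text{ a.e. on }\{u=u_b\}\}$. Network. $\sigma(t)=\max(t,0)$. $\mathcal{N}:\mathbb{R}^m\times\mathbb{R}\to\mathbb{R}$ is a ReLU network: with $z=(x,y)$, $n_0=m+1$, matrices $W_\ell\in\mathbb{R}^{n_\ell\times n_{\ell-1}}$ and vectors $b_\ell\in\mathbb{R}^{n_\ell}$ ($n_L=1$), set $N^{(1)}(z)=W_1z+b_1$, $N^{(\ell)}(z)=W_\ell\,\sigma(N^{(\ell-1)}(z))+b_\ell$ for $\ell=2,\dots,L$ ($\sigma$ componentwise), and $\mathcal{N}=N^{(L)}$. It is assumed that $y\mapsto\mathcal{N}(x,y)$ is monotonically increasing for every $x$. For $x,y,s$ let $\mathcal{N}_x'(y;s)=\lim_{t\to0^+}(\mathcal{N}(x,y+ts)-\mathcal{N}(x,y))/t$, and for functions $y,v$ on $\Omega$ let $N'(y;v)(x)=\mathcal{N}_x'(y(x);v(x))$.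 Control-to-state map. For $u\in L^p(\Omega)$, $y=S(u)$ is the unique (weak) solution of $-\Delta y+\mathcal{N}(\cdot,y)=u$ in $\Omega$, $y=0$ on $\partial\Omega$; it lies in $Y\cap C(\overline\Omega)$, $Y=\{y\in H_0^1(\Omega):\Delta y\in L^2(\Omega)\}$. $S:L^p(\Omega)\to Y$ is directionally differentiable, and $S'(u;h)$ is the unique solution $z_h$ of $-\Delta z_h+N'(y;z_h)=h$ in $\Omega$, $z_h=0$ on $\partial\Omega$, $y=S(u)$. The reduced objective is $\mathcal{J}(u)=\frac12\|S(u)-g\|_{L^2(\Omega)}^2+\frac\alpha2\|u\|_{L^2(\Omega)}^2$, with $\mathcal{J}'(u;h)=\langle S(u)-g,S'(u;h)\rangle+\alpha\langle u,h\rangle$. A point $u\in\mathcal{C}_{ad}$ is $B$-stationary if $\mathcal{J}'(u;h)\ge0$ for all $h\in T_{\mathcal{C}_{ad}}(u)$. Functional $q$. $q:L^2(\Omega)\times L^2(\Omega)\to\mathbb{R}$ is a symmetric functional (typically quadratic, i.e. from a bilinear form) with $v\mapsto q(v,v)$ convex and differentiable, and for constants $C_1,C_2>0$: $q(v,v)\ge C_1\|v\|_{L^2}^2$ and $q(v,v')\le C_2\|v\|_{L^2}\|v'\|_{L^2}$ for all $v,v'$. Smoothed derivative. $(\sigma_\epsilon)_{\epsilon>0}$ is a fixed canonical smoothing of $\sigma$: each $\sigma_\epsilon:\mathbb{R}\to\mathbb{R}$ is nonnegative, convex, increasing and $C^1$, $\sigma_\epsilon\to\sigma$ uniformly and $|\sigma_{\epsilon_1}-\sigma|\le|\sigma_{\epsilon_2}-\sigma|$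 pointwise for $0<\epsilon_1\le\epsilon_2$; moreover $\|\sigma_\epsilon-\sigma\|_\infty\le c\,\epsilon$ for all $\epsilon>0$ with some $c>0$. For $z=(x,y)$ and $s\in\mathbb{R}$ set $(\mathcal{D}^{(1)}_\epsilon)_x(y;s)=W_1(:,n_0)s$ ($W_1(:,n_0)$ is the last column of $W_1$), and for $\ell=2,\dots,L$ $$(\mathcal{D}^{(\ell)}_\epsilon)_x(y;s)=W_\ell\Big(\mathbf{1}_{(0,\infty)}(N^{(\ell-1)}(z))\,(\mathcal{D}^{(\ell-1)}_\epsilon)_x(y;s)+\mathbf{1}_{\{0\}}(N^{(\ell-1)}(z))\,\sigma_\epsilon\big((\mathcal{D}^{(\ell-1)}_\epsilon)_x(y;s)\big)\Big),$$ where the indicator vectors act as diagonal matrices and $\sigma_\epsilon$ acts componentwise; $(\mathcal{D}_\epsilon)_x=(\mathcal{D}_\epsilon^{(L)})_x$ and $D_\epsilon(y;v)(x)=(\mathcal{D}_\epsilon)_x(y(x);v(x))$. *)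

(* Defs.v *)
From HB Require Import structures.
From mathcomp Require Import all_boot all_order all_algebra.
From mathcomp Require Import all_classical all_reals all_analysis.

Set Implicit Arguments.
Unset Strict Implicit.
Unset Printing Implicit Defensive.
Import Order.TTheory GRing.Theory Num.Theory.
Import numFieldNormedType.Exports.
Local Open Scope classical_set_scope.
Local Open Scope ring_scope.

Definition rV_display : measure_display -> measure_display.
Proof. exact. Qed.

(* The product sigma-algebra on row vectors, as the library does for tuples;
   over a realType it is the Borel sigma-algebra. *)
Section measurable_rV.
Context d (T : sigmaRingType d) (n : nat).

Let coord : 'I_n -> 'rV[T]_n -> T := fun i x => x 0 i.

Let rV_set0 : g_sigma_preimage coord set0.
Proof. exact: sigma_algebra0. Qed.

Let rV_setC A : g_sigma_preimage coord A -> g_sigma_preimage coord (~` A).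
Proof. exact: sigma_algebraC. Qed.

Let rV_bigcup (F : _^nat) : (forall i, g_sigma_preimage coord (F i)) ->
  g_sigma_preimage coord (\bigcup_i (F i)).
Proof. exact: sigma_algebra_bigcup. Qed.

HB.instance Definition _ := @isMeasurable.Build (rV_display d)
  'rV[T]_n (g_sigma_preimage coord) rV_set0 rV_setC rV_bigcup.

Lemma measurable_coord (i : 'I_n) :
  measurable_fun [set: 'rV[T]_n] (fun x : 'rV[T]_n => x 0 i).
Proof.
move=> _ Y mY; rewrite setTI; apply: sub_sigma_algebra => /=.
rewrite -bigcup_seq/=; exists i => /=; first by rewrite mem_index_enum.
by exists Y => //; rewrite setTI.
Qed.

End measurable_rV.

Lemma measurable_fun_coord d1 d2 (T1 : measurableType d1)
    (T2 : measurableType d2) n (f : T1 -> 'rV[T2]_n) :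
  (forall i, measurable_fun setT (fun x => f x 0 i)) -> measurable_fun setT f.
Proof.
have -> : measurable_fun setT f <-> g_sigma_preimage
    (fun i x => f x 0 i) `<=` measurable.
  rewrite (g_sigma_preimage_comp (fun i (x : 'rV[T2]_n) => x 0 i) f).
  split=> [mf A [/= C preC <-]|prefS]; first exact: mf.
  by move=> _ A mA; apply: prefS; exists A.
move=> mf; apply: smallest_sub; first exact: sigma_algebra_measurable.
case: n => [|n] in f mf *; first by rewrite big_ord0.
rewrite -bigcup_mkord_ord; apply: bigcup_sub => i Ii.
by move=> A [B mB <-]; exact: mf.
Qed.

Section lebesgue_rV.
Context {R : realType}.

Definition cons_rV n (z : measurableTypeR R * 'rV[R]_n) : 'rV[R]_n.+1 :=
  row_mx (const_mx z.1 : 'rV_1) z.2.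

Lemma cons_rV0 n z : @cons_rV n z 0 ord0 = z.1.
Proof.
have -> : ord0 = lshift n (0 : 'I_1) :> 'I_n.+1 by exact/val_inj.
by rewrite [LHS]row_mxEl mxE.
Qed.

Lemma cons_rVS n z (i : 'I_n) : @cons_rV n z 0 (lift ord0 i) = z.2 0 i.
Proof.
have -> : lift ord0 i = rshift 1 i :> 'I_n.+1 by exact/val_inj.
by rewrite [LHS]row_mxEr.
Qed.

Lemma measurable_cons_rV n : measurable_fun setT (@cons_rV n).
Proof.
apply: measurable_fun_coord => i; have [->|] := eqVneq i ord0.
  rewrite (_ : (fun _ => _) = fst); first exact: measurable_fst.
  by apply/funext => z; rewrite cons_rV0.
rewrite eq_sym => /unlift_some[j -> _].
rewrite (_ : (fun _ => _) = (fun x : 'rV[R]_n => x 0 j) \o snd).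
  by apply: measurableT_comp => //; exact: measurable_coord.
by apply/funext => z; rewrite /= cons_rVS.
Qed.

Definition uncons_rV n (x : 'rV[R]_n.+1) : measurableTypeR R * 'rV[R]_n :=
  (x 0 ord0, \row_i x 0 (lift ord0 i)).

Lemma uncons_rVK n : cancel (@uncons_rV n) (@cons_rV n).
Proof.
move=> x; apply/rowP => i; have [->|] := eqVneq i ord0.
  by rewrite cons_rV0.
by rewrite eq_sym => /unlift_some[j -> _]; rewrite cons_rVS mxE.
Qed.

Lemma cons_rVK n : cancel (@cons_rV n) (@uncons_rV n).
Proof.
move=> [a x]; rewrite /uncons_rV cons_rV0; congr pair.
by apply/rowP => i; rewrite mxE cons_rVS.
Qed.

Lemma measurable_uncons_rV n : measurable_fun setT (@uncons_rV n).
Proof.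
apply/measurable_fun_pairP; split; first exact: measurable_coord.
apply: measurable_fun_coord => i.
rewrite (_ : (fun _ => _) = (fun x : 'rV[R]_n.+1 => x 0 (lift ord0 i))).
  exact: measurable_coord.
by apply/funext => x; rewrite /= mxE.
Qed.

Section cons.
Variables (n : nat) (mu : {sigma_finite_measure set 'rV[R]_n -> \bar R}).

Definition lebesgue_cons : set 'rV[R]_n.+1 -> \bar R :=
  pushforward ((@lebesgue_measure R) \x mu)%E (@cons_rV n).

Let lebesgue_cons0 : lebesgue_cons set0 = 0%E.
Proof. by rewrite /lebesgue_cons /pushforward preimage_set0 measure0. Qed.

Let lebesgue_cons_ge0 A : (0 <= lebesgue_cons A)%E.
Proof. by rewrite /lebesgue_cons /pushforward measure_ge0. Qed.

Let lebesgue_cons_sigma_additive : semi_sigma_additive lebesgue_cons.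
Proof.
move=> F mF tF mUF; rewrite /lebesgue_cons /pushforward preimage_bigcup.
apply: measure_semi_sigma_additive.
- by move=> k; rewrite -[X in measurable X]setTI; exact: measurable_cons_rV.
- apply/trivIsetP => /= i j _ _ ij; rewrite -preimage_setI.
  by move/trivIsetP : tF => /(_ _ _ _ _ ij) ->//; rewrite preimage_set0.
- by rewrite -preimage_bigcup -[X in measurable X]setTI;
    exact: measurable_cons_rV.
Qed.

HB.instance Definition _ := isMeasure.Build _ _ _ lebesgue_cons
  lebesgue_cons0 lebesgue_cons_ge0 lebesgue_cons_sigma_additive.

Let lebesgue_cons_sigma_finite : sigma_finite setT lebesgue_cons.
Proof.
have /sigma_finiteP[F [TF ndF Foo]] := sigma_finiteT (@lebesgue_measure R).
have /sigma_finiteP[G [TG ndG Goo]] := sigma_finiteT mu.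
exists (fun k => @uncons_rV n @^-1` (F k `*` G k)).
  rewrite -preimage_bigcup (_ : \bigcup_k _ = setT) ?preimage_setT//.
  rewrite -subTset => -[a x] _; have [i _ Fia] : (\bigcup_k F k) a by rewrite -TF.
  have [j _ Gjx] : (\bigcup_k G k) x by rewrite -TG.
  exists (maxn i j) => //; split.
    by move: a Fia; exact/subsetPset/ndF/leq_maxl.
  by move: x Gjx; exact/subsetPset/ndG/leq_maxr.
move=> k; have [mF Fk] := Foo k; have [mG Gk] := Goo k; split.
  rewrite -[X in measurable X]setTI; apply: measurable_uncons_rV => //.
  exact: measurableX.
rewrite /lebesgue_cons /pushforward -comp_preimage.
rewrite (_ : _ \o _ = id); last by apply/funext => z /=; rewrite cons_rVK.
by rewrite preimage_id product_measure1E// lte_mul_pinfty// ge0_fin_numE.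
Qed.

HB.instance Definition _ := Measure_isSigmaFinite.Build _ _ _ lebesgue_cons
  lebesgue_cons_sigma_finite.

End cons.

Fixpoint lebesgue_rV n : {sigma_finite_measure set 'rV[R]_n -> \bar R} :=
  match n with
  | 0 => dirac (0 : 'rV[R]_0)
  | k.+1 => lebesgue_cons (lebesgue_rV k)
  end.

End lebesgue_rV.
Arguments lebesgue_rV R n : clear implicits.

Section function_spaces.
Context {R : realType} {m : nat}.
Implicit Types (Omega : set 'rV[R]_m) (f v phi : 'rV[R]_m -> R).

Local Notation mu := (lebesgue_rV R m).

(* Near each boundary point, in suitable orthonormal coordinates [y *m Q], the
   set lies strictly above the graph of a Lipschitz function of the coordinates
   other than the [i]-th one. *)
Definition lipschitz_boundary Omega :=
  forall x, closure Omega x -> ~ Omega x ->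
  exists (Q : 'M[R]_m) (i : 'I_m) (gamma : 'rV[R]_m.-1 -> R) (U : set 'rV[R]_m),
    [/\ Q *m Q^T = 1%:M, lipschitz gamma, open U, U x &
      Omega `&` U =
      [set y | gamma (col' i (y *m Q)) < (y *m Q) 0 i] `&` U].

(* Elements of L^p(Omega) are represented by functions on R^m of which only the
   values on Omega matter. *)
Definition in_Lp Omega (p : \bar R) f := f \_ Omega \in Lfun mu p.

Definition ae_in Omega (P : 'rV[R]_m -> Prop) :=
  {ae mu, forall x, Omega x -> P x}.

Definition L2norm Omega f : R := fine 'N[mu]_2%:E[EFin \o (f \_ Omega)].

Definition inner Omega f v : R := \int[mu]_(x in Omega) (f x * v x).

Definition partial (i : 'I_m) f : 'rV[R]_m -> R := 'D_(delta_mx 0 i) f.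

Definition smooth f :=
  forall (s : seq 'I_m) x, differentiable (foldr partial f s) x.

Definition test_function Omega phi :=
  smooth phi /\
  exists K, [/\ compact K, K `<=` Omega & forall x, ~ K x -> phi x = 0].

(* [v] belongs to H^1_0(Omega) and [w] is its weak gradient: (v, w) is the limit
   in L^2 of the pairs (phi, grad phi), for phi in C_c^oo(Omega). *)
Definition H10_with_gradient Omega v (w : 'I_m -> 'rV[R]_m -> R) :=
  [/\ in_Lp Omega 2%:E v, forall i, in_Lp Omega 2%:E (w i) &
    exists phi : nat -> 'rV[R]_m -> R,
      [/\ forall k, test_function Omega (phi k),
          L2norm Omega (phi k \- v) @[k --> \oo] --> 0 &
          forall i, L2norm Omega (partial i (phi k) \- w i) @[k --> \oo] --> 0]].

(* v is a weak solution in H^1_0(Omega) of -Delta v + F(v) = f, v = 0 on the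
   boundary *)
Definition weak_solution Omega (F : ('rV[R]_m -> R) -> 'rV[R]_m -> R) f v :=
  exists2 w, H10_with_gradient Omega v w &
    forall phi, test_function Omega phi ->
      \sum_i inner Omega (w i) (partial i phi) + inner Omega (F v) phi =
      inner Omega f phi.

Record is_q Omega (q : ('rV[R]_m -> R) -> ('rV[R]_m -> R) -> R) : Prop := IsQ {
  (* q is well defined on almost everywhere equality classes *)
  q_ae : forall v v' f, in_Lp Omega 2%:E v -> in_Lp Omega 2%:E v' ->
    in_Lp Omega 2%:E f -> ae_in Omega (fun x => v x = v' x) -> q v f = q v' f;
  q_sym : forall v f, in_Lp Omega 2%:E v -> in_Lp Omega 2%:E f -> q v f = q f v;
  q_convex : forall v f (t : R), in_Lp Omega 2%:E v -> in_Lp Omega 2%:E f ->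
    0 <= t <= 1 ->
    let c := t \*: v \+ (1 - t) \*: f in
    q c c <= t * q v v + (1 - t) * q f f;
  (* Frechet differentiability of v |-> q v v on L^2(Omega) *)
  q_differentiable : forall v, in_Lp Omega 2%:E v ->
    exists A : ('rV[R]_m -> R) -> R,
    [/\ forall f h (t : R), in_Lp Omega 2%:E f -> in_Lp Omega 2%:E h ->
          A (t \*: f \+ h) = t * A f + A h,
        exists M : R, forall h, in_Lp Omega 2%:E h ->
          `|A h| <= M * L2norm Omega h &
        forall e : R, 0 < e -> exists2 d : R, 0 < d &
          forall h, in_Lp Omega 2%:E h -> L2norm Omega h < d ->
          `|q (v \+ h) (v \+ h) - q v v - A h| <= e * L2norm Omega h];
  q_coercive : exists2 C1 : R, 0 < C1 & forall v, in_Lp Omega 2%:E v ->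
    C1 * L2norm Omega v ^+ 2 <= q v v;
  q_bounded : exists2 C2 : R, 0 < C2 & forall v f,
    in_Lp Omega 2%:E v -> in_Lp Omega 2%:E f ->
    q v f <= C2 * L2norm Omega v * L2norm Omega f
}.

End function_spaces.

Section relu_networks.
Context {R : realType} {m : nat}.

Definition relu (t : R) : R := Num.max t 0.

(* [relu_net k]: networks on R^m x R of arbitrary depth with k outputs, given
   as the affine maps (W_l, b_l) *)
Inductive relu_net : nat -> Type :=
| FirstLayer n of 'M[R]_(n, m + 1) & 'cV[R]_n : relu_net n
| NextLayer n k of relu_net n & 'M[R]_(k, n) & 'cV[R]_k : relu_net k.

Fixpoint net_eval k (N : relu_net k) (x : 'rV[R]_m) (y : R) : 'cV[R]_k :=
  match N with
  | FirstLayer _ W b => W *m col_mx x^T (const_mx y) + b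
  | NextLayer _ _ N' W b => W *m map_mx relu (net_eval N' x y) + b
  end.

(* The smoothed directional derivative in y, in direction s; [sig] smooths relu *)
Fixpoint net_deriv (sig : R -> R) k (N : relu_net k) (x : 'rV[R]_m) (y s : R) :
    'cV[R]_k :=
  match N with
  | FirstLayer _ W _ => s *: col (rshift m 0) W
  | NextLayer n _ N' W _ =>
      let z := net_eval N' x y in
      let d := net_deriv sig N' x y s in
      W *m \col_(i < n) ((0 < z i 0)%R%:R * d i 0 + (z i 0 == 0)%:R * sig (d i 0))
  end.

Definition superpose_net (N : relu_net 1) (v : 'rV[R]_m -> R) : 'rV[R]_m -> R :=
  fun x => net_eval N x (v x) 0 0.

Definition superpose_deriv (sig : R -> R) (N : relu_net 1)
    (y v : 'rV[R]_m -> R) : 'rV[R]_m -> R :=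
  fun x => net_deriv sig N x (y x) (v x) 0 0.

Record canonical_smoothing (sig : R -> R -> R) : Prop := CanonicalSmoothing {
  smoothing_ge0 : forall e t : R, 0 < e -> 0 <= sig e t;
  smoothing_convex : forall e : R, 0 < e ->
    convex_function [set: R^o] (sig e : R^o -> R^o);
  smoothing_homo : forall e : R, 0 < e -> {homo sig e : s t / s <= t};
  smoothing_derivable : forall e t : R, 0 < e -> derivable (sig e) t 1;
  smoothing_C1 : forall e : R, 0 < e -> continuous (derive1 (sig e));
  smoothing_cvg : {uniform, sig e @[e --> 0^'+] --> relu};
  smoothing_mono : forall e1 e2 t : R, 0 < e1 -> e1 <= e2 ->
    `|sig e1 t - relu t| <= `|sig e2 t - relu t|;
  smoothing_rate : exists2 c : R, 0 < c & forall e t : R, 0 < e ->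
    `|sig e t - relu t| <= c * e
}.

End relu_networks.
Arguments relu_net R m : clear implicits.

Section control_problem.
Context {R : realType} {m : nat}.
Variables (Omega : set 'rV[R]_m) (N : relu_net R m 1).
Variables (g ua ub : 'rV[R]_m -> R) (alpha p : R).
Implicit Types u h d : 'rV[R]_m -> R.

(* Control-to-state map, by definite description of the weak solution *)
Definition state u : 'rV[R]_m -> R :=
  xget (cst 0) [set y | weak_solution Omega (superpose_net N) u y].

Definition objective u : R :=
  2^-1 * L2norm Omega (state u \- g) ^+ 2 + alpha / 2 * L2norm Omega u ^+ 2.

(* J'(u; h), the one-sided directional derivative *)
Definition objective_deriv u h : R :=
  lim (t^-1 * (objective (u \+ t \*: h) - objective u) @[t --> 0^'+]).

Definition admissible u :=
  in_Lp Omega p%:E u /\ ae_in Omega (fun x => ua x <= u x <= ub x).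

Definition contingent_cone u h :=
  [/\ in_Lp Omega p%:E h,
      ae_in Omega (fun x => u x = ua x -> 0 <= h x) &
      ae_in Omega (fun x => u x = ub x -> h x <= 0)].

Definition B_stationary u :=
  admissible u /\ forall h, contingent_cone u h -> 0 <= objective_deriv u h.

Variables (q : ('rV[R]_m -> R) -> ('rV[R]_m -> R) -> R) (sig : R -> R).

Definition subproblem_objective u h d : R :=
  2^-1 * q h h + inner Omega (state u \- g) d + alpha * inner Omega u h.

Definition subproblem_feasible u h d :=
  [/\ in_Lp Omega 2%:E h,
      weak_solution Omega (superpose_deriv sig N (state u)) h d &
      contingent_cone u h].

Definition subproblem_solution u h :=
  exists d, subproblem_feasible u h d /\
    forall h' d', subproblem_feasible u h' d' ->
      subproblem_objective u h d <= subproblem_objective u h' d'.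

End control_problem.

(* Main.v *)
Require Import Defs.
From HB Require Import structures.
From mathcomp Require Import all_boot all_order all_algebra.
From mathcomp Require Import all_classical all_reals all_analysis.
From mathcomp Require Import measurable_realfun.
From mathcomp Require Import ring lra.
Import Order.TTheory GRing.Theory Num.Theory.
Import numFieldNormedType.Exports.
Set Implicit Arguments.
Unset Strict Implicit.
Unset Printing Implicit Defensive.
Local Open Scope classical_set_scope.
Local Open Scope ring_scope.

(* The directional derivative of the network in [y] is the relu variant of its
   smoothed derivative; it is monotone and Lipschitz, and the smoothed derivative
   differs from it by at most [k = O(eps)], uniformly. Testing equations with the
   difference of two solutions and using the Poincare inequality, one gets that
   [J'(u; h) = <S(u) - g, z_h> + alpha <u, h>] with [z_h] the solution of the
   linearized equation, and that the [d_eps] belonging to [h] is [O(k)]-close to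
   [z_h]. If [J'(u; h0) < 0], then near [tau h0] there is a feasible point of the
   subproblem whose objective is at most [tau^2 C + tau J'(u; h0) + O(k)]; for a
   suitable [tau] and all small [eps] this is negative, and it bounds the optimal
   value, hence, up to [O(k)], also [J'(u; h_eps)], because [q(h, h) >= 0]. *)

(** * Semi-inner product spaces and monotone equations *)

(** Smoothing relu at the kinks can destroy the monotonicity of the derivative in its direction, so
    for a prescribed control the smoothed equation is never solved. Wherever it occurs, the
    smoothing error is moved to the right-hand side and only the linearized equation, which is
    monotone, is estimated. A given optimal pair is treated in this way; the competitor is a
    solution of the linearized equation whose control is corrected afterwards, and the correction
    has to respect the sign conditions of the cone.

    Existence is still needed for the state equation, because [state] is a chosen solution with a
    default value, and for the linearized one. Both follow from one abstract result about two
    semi-inner product spaces, of functions and of gradients: the energy of a linear equation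
    shifted by [K] is minimized, and the monotone term is then handled by a contraction.

    Seminorms appear because functions are not identified almost everywhere. Uniqueness accordingly
    means distance zero between two solutions, and it is a case of the stability estimate. *)

Section semi_inner_product.
Context {R : realType} {V : lmodType R}.

(** Definiteness is left out on purpose: the elements will be honest functions on the whole space,
    and the form integrates over [Omega] only, so it sees neither null sets nor values off
    [Omega]. *)
Record semi_inner (b : V -> V -> R) : Prop := SemiInner {
  ipC : forall u v, b u v = b v u;
  ipDl : forall u v w, b (u + v) w = b u w + b v w;
  ipZl : forall a u v, b (a *: u) v = a * b u v;
  ip_ge0 : forall u, 0 <= b u u }.

Definition ipnorm (b : V -> V -> R) (u : V) : R := Num.sqrt (b u u).

Definition ip_complete (b : V -> V -> R) := forall u_ : nat -> V,
  (forall e : R, 0 < e -> exists k0, forall k l, (k0 <= k)%N -> (k0 <= l)%N ->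
    ipnorm b (u_ k - u_ l) <= e) ->
  exists v, forall e : R, 0 < e -> exists k0, forall k, (k0 <= k)%N ->
    ipnorm b (u_ k - v) <= e.

Variables (b : V -> V -> R) (bP : semi_inner b).
Local Notation n := (ipnorm b).

Lemma ipDr u v w : b w (u + v) = b w u + b w v.
Proof. by rewrite ipC// ipDl// !(ipC bP w). Qed.

Lemma ipZr a u v : b u (a *: v) = a * b u v.
Proof. by rewrite ipC// ipZl// (ipC bP u). Qed.

Lemma ipNl u v : b (- u) v = - b u v.
Proof. by rewrite -scaleN1r ipZl// mulN1r. Qed.

Lemma ipNr u v : b u (- v) = - b u v.
Proof. by rewrite ipC// ipNl (ipC bP u). Qed.

Lemma ip0l v : b 0 v = 0.
Proof. by rewrite -(scale0r 0) ipZl// mul0r. Qed.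

Lemma ipBl u v w : b (u - v) w = b u w - b v w.
Proof. by rewrite ipDl// ipNl. Qed.

Lemma ipBr u v w : b w (u - v) = b w u - b w v.
Proof. by rewrite ipDr ipNr. Qed.

Lemma ipnorm_ge0 u : 0 <= n u.
Proof. exact: sqrtr_ge0. Qed.

Lemma ipnorm_sqr u : n u ^+ 2 = b u u.
Proof. by rewrite sqr_sqrtr// ip_ge0. Qed.

Lemma ipnorm0 : n 0 = 0.
Proof. by rewrite /ipnorm ip0l sqrtr0. Qed.

Lemma ipnormZ a u : n (a *: u) = `|a| * n u.
Proof.
by rewrite /ipnorm ipZl// ipZr mulrA -expr2 sqrtrM ?sqr_ge0// sqrtr_sqr.
Qed.

Lemma ipnormN u : n (- u) = n u.
Proof. by rewrite -scaleN1r ipnormZ normrN normr1 mul1r. Qed.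

Lemma ipnorm_distC u v : n (u - v) = n (v - u).
Proof. by rewrite -ipnormN opprB. Qed.

Lemma ip_CS u v : `|b u v| <= n u * n v.
Proof.
have H t : 0 <= b u u + 2 * t * b u v + t ^+ 2 * b v v.
  have := ip_ge0 bP (u + t *: v).
  rewrite ipDl// !ipDr !ipZl// !ipZr (ipC bP v u); lra.
rewrite /ipnorm -sqrtrM ?ip_ge0// -sqrtr_sqr ler_wsqrtr//.
have [v0|v0] := eqVneq (b v v) 0.
  have [->|uv0] := eqVneq (b u v) 0; first by rewrite expr0n/= v0 mulr0.
  (* When [b v v = 0] the quadratic is affine in [t], and this [t] would give it the value -1. *)
  have := H (- (b u u + 1) / (2 * b u v)); rewrite v0 mulr0 addr0.
  have -> : 2 * (- (b u u + 1) / (2 * b u v)) * b u v = - (b u u + 1) by field.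
  by lra.
have v_gt0 : 0 < b v v by rewrite lt_def v0 ip_ge0.
have := H (- b u v / b v v).
have -> : b u u + 2 * (- b u v / b v v) * b u v + (- b u v / b v v) ^+ 2 * b v v
  = (b u u * b v v - b u v ^+ 2) / b v v by field.
by rewrite pmulr_lge0 ?invr_gt0// subr_ge0.
Qed.

Lemma ip_le u v : b u v <= n u * n v.
Proof. exact: le_trans (ler_norm _) (ip_CS u v). Qed.

Lemma ipnormD u v : n (u + v) <= n u + n v.
Proof.
rewrite -(@ler_pXn2r _ 2)// ?nnegrE ?addr_ge0 ?ipnorm_ge0//.
rewrite ipnorm_sqr ipDl// !ipDr (ipC bP v u) sqrrD !ipnorm_sqr.
have := ip_le u v; lra.
Qed.

Lemma ipnormB u v : n (u - v) <= n u + n v.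
Proof. by rewrite -[in leRHS](ipnormN v) ipnormD. Qed.

Lemma ipnorm_split u v w : n (u - w) <= n (u - v) + n (v - w).
Proof. by apply: le_trans (ipnormD _ _); rewrite addrA subrK. Qed.

Lemma ipnorm_eq0 u v : n u = 0 -> b u v = 0.
Proof.
move=> u0; apply/eqP; rewrite -normr_le0; apply: le_trans (ip_CS u v) _.
by rewrite u0 mul0r.
Qed.

End semi_inner_product.

(** Passage to the limit without filters: estimates on a closure hold up to a fixed multiple of an
    arbitrary [e]. If [a] were positive, [e = a / (2 * c)] would give [a <= a / 2]. *)
Lemma le_all_eps (R : realFieldType) (a c : R) :
  (forall e : R, 0 < e -> a <= c * e) -> a <= 0.
Proof.
move=> H; rewrite leNgt; apply/negP => a0.
have c0 : 0 < c by have := H 1 ltr01; rewrite mulr1; exact: lt_le_trans.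
have := H (a / (2 * c)); rewrite divr_gt0 ?mulr_gt0// => /(_ isT).
have -> : c * (a / (2 * c)) = a / 2 by field; rewrite gt_eqF.
by lra.
Qed.

(** * The Dirichlet problem over abstract semi-inner product spaces *)

Section dirichlet.
Context {R : realType} {X Y : lmodType R}.
Variables (bX : X -> X -> R) (bY : Y -> Y -> R) (tst : X -> Y -> Prop).
Hypotheses (bXP : semi_inner bX) (bYP : semi_inner bY).
Hypotheses (cX : ip_complete bX) (cY : ip_complete bY).
Hypothesis tst0 : tst 0 0.
Hypothesis tst_lin : forall a x y x' y', tst x y -> tst x' y' ->
  tst (a *: x + x') (a *: y + y').
Variable C : R.
Hypothesis C_gt0 : 0 < C.
Hypothesis poincare : forall x y, tst x y -> ipnorm bX x <= C * ipnorm bY y.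
Local Notation nX := (ipnorm bX).
Local Notation nY := (ipnorm bY).

Let bil := (ipNl bXP, ipNr bXP, ipNl bYP, ipNr bYP, ipDl bXP, ipDr bXP,
  ipDl bYP, ipDr bYP, ipZl bXP, ipZr bXP, ipZl bYP, ipZr bYP).

(* [tst] is the graph of the gradient on test functions, so [closure_pair v w]
   says that [v] is in H^1_0 with weak gradient [w], and [weak_poisson f v w] that
   moreover [- Laplacian v = f]. *)
Definition closure_pair v w := forall e : R, 0 < e ->
  exists x y, [/\ tst x y, nX (x - v) <= e & nY (y - w) <= e].

Definition weak_poisson f v w := closure_pair v w /\
  forall x y, tst x y -> bY w y = bX f x.

Lemma closure_pair_lin a v w v' w' : closure_pair v w -> closure_pair v' w' ->
  closure_pair (a *: v + v') (a *: w + w').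
Proof.
move=> H H' e e0; set c := `|a| + 1.
have c0 : 0 < c by rewrite ltr_wpDl.
have d0 : 0 < e / (2 * c) by rewrite divr_gt0 ?mulr_gt0.
have [x [y [xy xv yw]]] := H _ d0; have [x' [y' [xy' xv' yw']]] := H' _ d0.
have E : `|a| * (e / (2 * c)) + e / (2 * c) <= e.
  have -> : `|a| * (e / (2 * c)) + e / (2 * c) = e / 2.
    rewrite /c; field; rewrite gt_eqF//.
  by lra.
exists (a *: x + x'), (a *: y + y'); split; first exact: tst_lin.
  rewrite opprD addrACA -scalerBr.
  apply: (le_trans (ipnormD bXP _ _)); apply: le_trans E.
  by rewrite ipnormZ// lerD// ler_wpM2l.
rewrite opprD addrACA -scalerBr.
apply: (le_trans (ipnormD bYP _ _)); apply: le_trans E.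
by rewrite ipnormZ// lerD// ler_wpM2l.
Qed.

Lemma weak_poisson_lin a f v w f' v' w' :
  weak_poisson f v w -> weak_poisson f' v' w' ->
  weak_poisson (a *: f + f') (a *: v + v') (a *: w + w').
Proof.
move=> [H E] [H' E']; split; first exact: closure_pair_lin.
by move=> x y xy; rewrite !bil (E _ _ xy) (E' _ _ xy).
Qed.

Lemma weak_poissonB f v w f' v' w' :
  weak_poisson f v w -> weak_poisson f' v' w' ->
  weak_poisson (f - f') (v - v') (w - w').
Proof.
move=> H H'; have := weak_poisson_lin (-1) H' H.
by rewrite !scaleN1r ![- _ + _]addrC.
Qed.

(** Both sides are continuous in the test pair, so the equation extends from test functions to all
    of H^1_0; in particular a solution may be tested with itself. *)
Lemma weak_poisson_test f v w v' w' : weak_poisson f v w ->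
  closure_pair v' w' -> bY w w' = bX f v'.
Proof.
move=> [_ E] H'; apply/eqP; rewrite -subr_eq0 -normr_le0.
apply: (@le_all_eps _ _ (nY w + nX f)) => e e0.
have [x [y [xy xv yw]]] := H' _ e0.
have -> : bY w w' - bX f v' = bX f (x - v') - bY w (y - w').
  by rewrite !bil (E _ _ xy); lra.
rewrite mulrDl [leRHS]addrC; apply: (le_trans (ler_normB _ _)).
by apply: lerD; apply: (le_trans (ip_CS _ _ _)) => //;
  rewrite ler_wpM2l ?ipnorm_ge0.
Qed.

Lemma closure_poincare v w : closure_pair v w -> nX v <= C * nY w.
Proof.
move=> H; rewrite -subr_le0; apply: (@le_all_eps _ _ (C + 1)) => e e0.
have [x [y [xy xv yw]]] := H _ e0.
have h1 : nX v <= nX x + e.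
  have := ipnormB bXP x (x - v); rewrite opprB addrC subrK => /le_trans; apply.
  by rewrite lerD.
have h2 : nY y <= nY w + e.
  have := ipnormD bYP (y - w) w; rewrite subrK => /le_trans; apply.
  by rewrite addrC lerD.
have := poincare xy.
have : C * nY y <= C * (nY w + e) by rewrite ler_wpM2l// ltW.
by lra.
Qed.

Lemma weak_poisson_energy f v w : weak_poisson f v w ->
  nX v ^+ 2 <= C ^+ 2 * bX f v.
Proof.
move=> H; rewrite -(weak_poisson_test H H.1) -ipnorm_sqr// -exprMn.
have /closure_poincare vw := H.1.
by rewrite ler_pXn2r// ?nnegrE ?mulr_ge0 ?ipnorm_ge0// ltW.
Qed.

(** The assumption bounds the pairing [bX f v] instead of [f], because [f] will contain a monotone
    term, which is controlled only through the sign of its pairing with [v]. *)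
Lemma weak_poisson_bound f v w r : weak_poisson f v w ->
  bX f v <= r * nX v -> 0 <= r -> nX v <= C ^+ 2 * r.
Proof.
move=> /weak_poisson_energy H fr r0.
have [->|v0] := eqVneq (nX v) 0; first by rewrite mulr_ge0 ?sqr_ge0.
rewrite -(@ler_pM2r _ (nX v)) ?lt_def ?v0 ?ipnorm_ge0//.
rewrite -expr2 -mulrA; apply: (le_trans H).
by rewrite ler_wpM2l ?sqr_ge0.
Qed.

Section linear_existence.
Variables (K : R) (f : X).
Hypothesis K_gt0 : 0 < K.

(** Twice the energy whose Euler-Lagrange equation is [- Laplacian x + K x = f], evaluated at test
    pairs only. *)
Let E x y := bY y y + K * bX x x - 2 * bX f x.

Let E_lb x y : - (bX f f / K) <= E x y.
Proof.
have := ip_ge0 bXP (K *: x - f).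
rewrite !bil (ipC bXP x f) => H.
have : 0 <= (K * (K * bX x x) - K * bX f x - (K * bX f x - bX f f)) / K.
  by rewrite divr_ge0// ltW.
have -> : (K * (K * bX x x) - K * bX f x - (K * bX f x - bX f f)) / K =
   K * bX x x - 2 * bX f x + bX f f / K by field; rewrite gt_eqF.
have := ip_ge0 bYP y; rewrite /E; lra.
Qed.

Let S := [set r | exists x y, tst x y /\ r = E x y].
Let I := inf S.

Let S_inf : has_inf S.
Proof.
split; first by exists (E 0 0), 0, 0.
by exists (- (bX f f / K)) => _ [x [y [_ ->]]].
Qed.

Let I_le x y : tst x y -> I <= E x y.
Proof. by move=> xy; apply: ge_inf; [exact: S_inf.2|exists x, y]. Qed.

Let min_seq (e : R) : 0 < e -> exists2 z, tst z.1 z.2 & E z.1 z.2 <= I + e.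
Proof.
move=> e0; have [_ [x [y [xy ->]]] /ltW xyI] := inf_adherent e0 S_inf.
by exists (x, y).
Qed.

(** Parallelogram identity for the quadratic part of [E]: the midpoint is again a test pair, so its
    energy is at least [I]. Hence minimizing sequences are Cauchy. *)
Let near_min x y x' y' (d d' : R) : tst x y -> tst x' y' ->
  E x y <= I + d -> E x' y' <= I + d' ->
  bY (y - y') (y - y') + K * bX (x - x') (x - x') <= 2 * (d + d').
Proof.
move=> xy xy' H H'.
have /I_le : tst (2^-1 *: x + (2^-1 *: x' + 0)) (2^-1 *: y + (2^-1 *: y' + 0)).
  by do 2 apply: tst_lin => //.
rewrite !addr0 /E !bil.
rewrite (ipC bXP x' x) (ipC bYP y' y).
by move: H H'; rewrite /E; lra.
Qed.

Lemma shifted_poisson_exists : exists v w, weak_poisson (f - K *: v) v w.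
Proof.
have [d [d0 small]] : exists d : nat -> R, (forall k, 0 < d k) /\
    forall e : R, 0 < e -> exists k0, forall k, (k0 <= k)%N -> d k <= e.
  exists (fun k => k.+1%:R^-1); split=> [k|e e0]; first by rewrite invr_gt0.
  exists (Num.truncn e^-1) => k kk.
  rewrite -[leRHS]invrK lef_pV2 ?posrE ?invr_gt0//.
  by apply/ltW/(lt_le_trans (truncnS_gt _)); rewrite ler_nat ltnS.
have /choice[z zP] : forall k : nat, exists z : X * Y, tst z.1 z.2 /\
    E z.1 z.2 <= I + d k.
  by move=> k; have [z] := min_seq (d0 k); exists z.
have cauchy (e : R) : 0 < e -> exists k0, forall k l, (k0 <= k)%N -> (k0 <= l)%N ->
    nX ((z k).1 - (z l).1) <= e /\ nY ((z k).2 - (z l).2) <= e.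
  (* [m] lies below both weights 1 and [K] of the quadratic part, so one bound by [m * e ^+ 2]
     controls both norms. *)
  move=> e0; pose m : R := Num.min 1 K.
  have m0 : 0 < m by rewrite lt_min ltr01.
  have [|k0 k0P] := small (m * e ^+ 2 / 4).
    by rewrite divr_gt0// mulr_gt0// exprn_gt0.
  exists k0 => k l k0k k0l.
  have [kt kE] := zP k; have [lt lE] := zP l.
  have := near_min kt lt kE lE; have := k0P _ k0k; have := k0P _ k0l.
  move=> hl hk; rewrite -(ipnorm_sqr bXP) -(ipnorm_sqr bYP) => H.
  have {H}H : nY ((z k).2 - (z l).2) ^+ 2 + K * nX ((z k).1 - (z l).1) ^+ 2 <=
     m * e ^+ 2.
    by lra.
  have m1 : m * e ^+ 2 <= e ^+ 2.
    by rewrite -[leRHS]mul1r ler_wpM2r ?sqr_ge0// ge_min lexx.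
  have mK : m * e ^+ 2 <= K * e ^+ 2.
    by rewrite ler_wpM2r ?sqr_ge0// ge_min lexx orbT.
  have p1 : 0 <= nY ((z k).2 - (z l).2) ^+ 2 by exact: sqr_ge0.
  have p2 : 0 <= K * nX ((z k).1 - (z l).1) ^+ 2.
    by rewrite mulr_ge0 ?sqr_ge0// ltW.
  split; rewrite -(@ler_pXn2r _ 2)// ?nnegrE ?ipnorm_ge0// ?(ltW e0)//.
    by rewrite -(ler_pM2l K_gt0); lra.
  by lra.
have [v vP] : exists v, forall e : R, 0 < e -> exists k0, forall k, (k0 <= k)%N ->
    nX ((z k).1 - v) <= e.
  apply: (cX (u_ := fun k => (z k).1)) => e /cauchy[k0 k0P].
  by exists k0 => k l k0k k0l; case: (k0P k l k0k k0l).
have [w wP] : exists w, forall e : R, 0 < e -> exists k0, forall k, (k0 <= k)%N ->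
    nY ((z k).2 - w) <= e.
  apply: (cY (u_ := fun k => (z k).2)) => e /cauchy[k0 k0P].
  by exists k0 => k l k0k k0l; case: (k0P k l k0k k0l).
have approx (e : R) : 0 < e -> exists k, [/\ nX ((z k).1 - v) <= e,
    nY ((z k).2 - w) <= e & d k <= e].
  move=> e0; have [k1 k1P] := vP _ e0; have [k2 k2P] := wP _ e0.
  have [k3 k3P] := small _ e0; exists (maxn k1 (maxn k2 k3)).
  by split; [apply: k1P|apply: k2P|apply: k3P]; rewrite !leq_max leqnn ?orbT.
exists v, w; split=> [e /approx[k [kv kw _]]|x y xy].
  by exists (z k).1, (z k).2; split => //; have [] := zP k.
rewrite !bil; set g := bY w y + K * bX v x - bX f x.
suff : g = 0 by rewrite /g; lra.
set a := bY y y + K * bX x x.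
have a0 : 0 <= a by rewrite addr_ge0 ?mulr_ge0 ?ip_ge0// ltW.
(* Here [g] is half the first variation at the limit [(v, w)]. The limit is not a test pair, so the
   variation is made at the approximants [z k] and the error is sent to 0. *)
have var (t : R) : 0 <= 2 * t * g + t ^+ 2 * a.
  rewrite -oppr_le0; set c := nY y + K * nX x.
  apply: (@le_all_eps _ _ (1 + 2 * `|t| * c)) => e /approx[k [kv kw ke]].
  have [kt kE] := zP k.
  have := I_le (tst_lin t xy kt).
  rewrite /E !bil (ipC bXP (z k).1) (ipC bYP (z k).2).
  move=> HI; move: kE; rewrite /E => kE.
  have h1 : `|bY ((z k).2 - w) y| <= e * nY y.
    by apply: (le_trans (ip_CS bYP _ _)); rewrite ler_wpM2r ?ipnorm_ge0.
  have h2 : `|bX ((z k).1 - v) x| <= e * nX x.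
    by apply: (le_trans (ip_CS bXP _ _)); rewrite ler_wpM2r ?ipnorm_ge0.
  have h3 : t * (bY ((z k).2 - w) y + K * bX ((z k).1 - v) x) <= `|t| * (e * c).
    apply: (le_trans (ler_norm _)); rewrite normrM ler_wpM2l//.
    apply: (le_trans (ler_normD _ _)); rewrite /c mulrDr lerD//.
    by rewrite normrM (gtr0_norm K_gt0) mulrCA ler_wpM2l// ltW.
  move: h3; rewrite !bil (ipC bYP (z k).2 y) (ipC bXP (z k).1 x) /g /a.
  by move: HI kE ke; rewrite (ipC bYP w y) (ipC bXP v x); lra.
(* Dividing by [a + 1] instead of [a] covers [a = 0]; the value is a negative multiple of
   [(g / (a + 1)) ^+ 2], which forces [g = 0]. *)
have := var (- g / (a + 1)).
have -> : 2 * (- g / (a + 1)) * g + (- g / (a + 1)) ^+ 2 * a =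
   - (g / (a + 1)) ^+ 2 * (a + 2) by field; lra.
rewrite mulNr oppr_ge0 pmulr_lle0; last by lra.
rewrite real_exprn_even_le0//= ?num_real// mulf_eq0 invr_eq0.
by case/orP => /eqP //; lra.
Qed.

End linear_existence.

(* Fixed point of [u |-> (- Laplacian + K)^-1 (f + K u - Phi u)], a contraction
   because [id - Phi / K] is nonexpansive and [- Laplacian] is coercive. *)
Lemma monotone_poisson_exists (K : R) (Phi : X -> X) (f : X) : 0 < K ->
  (forall u v, nX ((K *: u - Phi u) - (K *: v - Phi v)) <= K * nX (u - v)) ->
  exists v w, weak_poisson (f - Phi v) v w.
Proof.
move=> K0 PhiK.
have /choice[T TP] : forall u, exists v, exists w,
    weak_poisson ((f + (K *: u - Phi u)) - K *: v) v w.
  by move=> u; exact: shifted_poisson_exists.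
(* For the difference [e] of two images and [r] the distance of their arguments, the energy estimate
   reads [e ^+ 2 <= C ^+ 2 * (K * r * e - K * e ^+ 2)], that is,
   [(1 + K * C ^+ 2) * e <= K * C ^+ 2 * r]. *)
set th := K * C ^+ 2 / (1 + K * C ^+ 2).
have C2 : 0 < C ^+ 2 by rewrite exprn_gt0.
have D0 : 0 < 1 + K * C ^+ 2 by rewrite addr_gt0 ?mulr_gt0.
have th0 : 0 <= th by rewrite divr_ge0 ?mulr_ge0 ?ltW.
have th1 : th < 1 by rewrite ltr_pdivrMr// mul1r ltrDr.
have contr u u' : nX (T u - T u') <= th * nX (u - u').
  have [w H] := TP u; have [w' H'] := TP u'.
  have := weak_poisson_energy (weak_poissonB H H').
  set G := K *: u - Phi u; set G' := K *: u' - Phi u'.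
  have -> : f + G - K *: T u - (f + G' - K *: T u') = (G - G') - K *: (T u - T u').
    by rewrite scalerBr opprD addrACA -opprD (opprD f) [f + G + _]addrACA subrr add0r.
  rewrite (ipBl bXP _ _ (T u - T u')) (ipZl bXP) -(ipnorm_sqr bXP).
  have := ip_le bXP (G - G') (T u - T u').
  have := PhiK u u'; rewrite -/G -/G' => h1 h2 h3.
  have h4 : bX (G - G') (T u - T u') <= K * nX (u - u') * nX (T u - T u').
    by apply: (le_trans h2); rewrite ler_wpM2r ?ipnorm_ge0.
  have [->|d0] := eqVneq (nX (T u - T u')) 0; first by rewrite mulr_ge0 ?ipnorm_ge0.
  rewrite /th mulrAC ler_pdivlMr//.
  rewrite -(@ler_pM2r _ (nX (T u - T u'))) ?lt_def ?d0 ?ipnorm_ge0//.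
  have : C ^+ 2 * bX (G - G') (T u - T u') <=
     C ^+ 2 * (K * nX (u - u') * nX (T u - T u')) by rewrite ler_pM2l.
  by move: h3; rewrite mulrBr; lra.
pose u_ k := iter k T 0.
have contr_iter k u u' : nX (iter k T u - iter k T u') <= th ^+ k * nX (u - u').
  elim: k => [|k IH]; first by rewrite expr0 mul1r.
  by rewrite !iterS; apply: (le_trans (contr _ _)); rewrite exprS -mulrA ler_wpM2l.
set M := nX (u_ 1%N - u_ 0%N) / (1 - th).
have M0 : 0 <= M by rewrite divr_ge0 ?ipnorm_ge0// subr_ge0 ltW.
have bnd k : nX (u_ k - u_ 0%N) <= M.
  elim: k => [|k IH]; first by rewrite subrr ipnorm0.
  apply: (le_trans (ipnorm_split bXP _ (u_ 1%N) _)).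
  have h : nX (u_ k.+1 - u_ 1%N) <= th * M.
    by apply: (le_trans (contr _ _)); rewrite ler_wpM2l.
  have -> : M = th * M + nX (u_ 1%N - u_ 0%N).
    by rewrite /M; field; lra.
  by rewrite lerD.
have thk (e : R) : 0 < e -> exists k0, forall k, (k0 <= k)%N -> th ^+ k * (2 * M) <= e.
  move=> e0.
  have cv : (fun k => th ^+ k * (2 * M)) @ \oo --> (0 : R).
    by rewrite -[X in _ --> X](mul0r (2 * M)); apply: cvgMl;
      apply: cvg_expr; rewrite ger0_norm.
  have /cvgrPdist_le/(_ _ e0)[k0 _ k0P] := cv.
  exists k0 => k /k0P /=; rewrite sub0r normrN ger0_norm//.
  by rewrite mulr_ge0 ?exprn_ge0// mulr_ge0.
have [u uP] : exists u, forall e : R, 0 < e -> exists k0, forall k, (k0 <= k)%N ->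
    nX (u_ k - u) <= e.
  apply: cX => e /thk[k0 k0P]; exists k0 => k l k0k k0l.
  apply: le_trans (k0P _ (leqnn k0)).
  rewrite /u_ -(subnKC k0k) -(subnKC k0l) !iterD.
  apply: (le_trans (contr_iter _ _ _)); rewrite ler_wpM2l ?exprn_ge0//.
  apply: (le_trans (ipnorm_split bXP _ (u_ 0%N) _)).
  by rewrite mulr_natl mulr2n lerD ?(bnd (k - k0)%N)// (ipnorm_distC bXP) (bnd (l - k0)%N).
have fix_u : nX (T u - u) = 0.
  apply/eqP; rewrite eq_le ipnorm_ge0 andbT.
  apply: (@le_all_eps _ _ 2) => e /uP[k0 k0P].
  apply: (le_trans (ipnorm_split bXP _ (u_ k0.+1) _)).
  rewrite mulr_natl mulr2n lerD//; last exact: k0P.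
  rewrite ipnorm_distC//; apply: (le_trans (contr _ _)).
  apply: le_trans (k0P _ (leqnn _)).
  by rewrite ler_piMl ?ipnorm_ge0// ltW.
(* [T u] and [u] are only at distance zero. The solution has to be [T u], which already carries a
   gradient; replacing [u] by [T u] on the right-hand side changes it by an element of norm zero. *)
have [w [cl eqw]] := TP u; exists (T u), w; split => // x y xy.
rewrite (eqw _ _ xy); apply/eqP; rewrite -subr_eq0 -(ipBl bXP); apply/eqP.
apply: ipnorm_eq0 => //; apply/eqP; rewrite eq_le ipnorm_ge0 andbT.
have -> : f + (K *: u - Phi u) - K *: T u - (f - Phi (T u)) =
   (K *: u - Phi u) - (K *: T u - Phi (T u)).
  by rewrite opprD addrACA -opprD [f + _]addrC addrK.
apply: (le_trans (PhiK _ _)).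
by rewrite ipnorm_distC// fix_u mulr0.
Qed.

End dirichlet.

(** * Stability and differentiation of monotone equations *)

Section monotone.
Context {R : realType} {X Y : lmodType R}.
Variables (bX : X -> X -> R) (bY : Y -> Y -> R) (tst : X -> Y -> Prop).
Hypotheses (bXP : semi_inner bX) (bYP : semi_inner bY).
Hypothesis tst_lin : forall a x y x' y', tst x y -> tst x' y' ->
  tst (a *: x + x') (a *: y + y').
Variable C : R.
Hypothesis C_gt0 : 0 < C.
Hypothesis poincare : forall x y, tst x y -> ipnorm bX x <= C * ipnorm bY y.
Local Notation nX := (ipnorm bX).
Local Notation poisson := (weak_poisson bX bY tst).

Definition ip_monotone (Phi : X -> X) :=
  forall u v, 0 <= bX (Phi u - Phi v) (u - v).

(** Test the difference of the two equations with [v - v']: the monotone term has the good sign and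
    is dropped. The factor [C ^+ 2] comes from using the Poincare inequality on both sides. For
    [f = f'] this is uniqueness up to the seminorm. *)
Lemma poisson_stable (Phi : X -> X) f v w f' v' w' : ip_monotone Phi ->
  poisson (f - Phi v) v w -> poisson (f' - Phi v') v' w' ->
  nX (v - v') <= C ^+ 2 * nX (f - f').
Proof.
move=> mono H H'.
have HH := weak_poissonB bXP bYP tst_lin H H'.
apply: (weak_poisson_bound bXP bYP C_gt0 poincare HH); last exact: ipnorm_ge0.
rewrite (_ : f - _ - _ = (f - f') - (Phi v - Phi v')); last first.
  by rewrite opprD addrACA -opprD.
rewrite (ipBl bXP); apply: le_trans (ip_le bXP _ _).
by rewrite gerBl mono.
Qed.

(** The difference quotient of the solutions itself solves an equation with right-hand side [h],
    whose operator [Psi] is the difference quotient of [Phi] at [y0] and is again monotone. The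
    linearized solution [z], with [psi] in the role of the derivative of [Phi] in direction [z],
    solves the same equation up to the residual [psi - Psi z], and stability compares the two. *)
Lemma poisson_deriv (Phi : X -> X) u h psi y0 w0 yt wt z wz (t : R) : 0 < t ->
  ip_monotone Phi -> poisson (u - Phi y0) y0 w0 ->
  poisson (t *: h + u - Phi yt) yt wt -> poisson (h - psi) z wz ->
  nX (t^-1 *: (yt - y0) - z) <=
    C ^+ 2 * nX (t^-1 *: (Phi (y0 + t *: z) - Phi y0) - psi).
Proof.
move=> t0 mono H0 Ht Hz; have tN0 : t != 0 by rewrite gt_eqF.
pose Psi s := t^-1 *: (Phi (y0 + t *: s) - Phi y0).
have Psi_mono : ip_monotone Psi.
  move=> a b; rewrite -scalerBr opprD addrACA subrr addr0.
  rewrite (ipZl bXP) mulr_ge0 ?invr_ge0 ?(ltW t0)//.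
  have := mono (y0 + t *: a) (y0 + t *: b).
  by rewrite opprD [X in bX _ X]addrACA subrr add0r -scalerBr (ipZr bXP) pmulr_rge0.
rewrite (ipnorm_distC bXP (_ *: (Phi _ - _))).
rewrite (_ : psi - _ = h - (h - psi + Psi z)); last first.
  by rewrite !opprD opprK addrA addrA subrr add0r.
have HB := weak_poissonB bXP bYP tst_lin Ht H0.
have HD := weak_poisson_lin bXP bYP tst_lin t^-1 HB (weak_poissonB bXP bYP tst_lin HB HB).
move: HD; rewrite !subrr !addr0 => HD.
apply: (poisson_stable (Phi := Psi) (w := t^-1 *: (wt - w0)) (w' := wz)) => //; last first.
  by rewrite addrK.
rewrite (_ : h - Psi _ = t^-1 *: (t *: h + u - Phi yt - (u - Phi y0)))//.
rewrite /Psi scalerA divff// scale1r [y0 + _]addrC subrK.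
rewrite opprD opprK -addrA [- Phi yt + _]addrA [- Phi yt - u]addrC !addrA.
rewrite addrK -addrA [RHS]scalerDr scalerA mulVf// scale1r; congr (_ + _).
by rewrite -scalerN opprB addrC.
Qed.

End monotone.

Lemma weak_poissonZ {R : realType} {X Y : lmodType R} (bX : X -> X -> R)
    (bY : Y -> Y -> R) (tst : X -> Y -> Prop) (bXP : semi_inner bX)
    (bYP : semi_inner bY)
    (tst_lin : forall a x y x' y', tst x y -> tst x' y' ->
      tst (a *: x + x') (a *: y + y')) a f v w :
  weak_poisson bX bY tst f v w ->
  weak_poisson bX bY tst (a *: f) (a *: v) (a *: w).
Proof.
move=> H; have := weak_poisson_lin bXP bYP tst_lin (a - 1) H H.
by rewrite !scalerBl !scale1r !subrK.
Qed.

(** * The space L^2 *)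

Section L2.
Context {R : realType} {d} {T : measurableType d}.
Variables (mu : {measure set T -> \bar R}) (D : set T).
Hypothesis mD : measurable D.

Lemma le1_2 : (1 <= 2%:E :> \bar R)%E.
Proof. by rewrite lee_fin ler1n. Qed.

Local Notation L2 := (LfunType mu le1_2).
Implicit Types f g : L2.

Definition l2ip (f g : L2) : R := \int[mu]_(x in D) (f x * g x).

Lemma Lfun2P (f : T -> R) : measurable_fun setT f ->
  (\int[mu]_x (f x ^+ 2)%:E < +oo)%E -> f \in Lfun mu 2%:E.
Proof.
move=> mf fi; rewrite inE; apply/andP; split; rewrite inE//=.
rewrite /finite_norm unlock poweR_lty//; apply: le_lt_trans fi.
rewrite le_eqVlt; apply/orP; left; apply/eqP/eq_integral => x _ /=.
by rewrite powR_mulrn// real_normK// num_real.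
Qed.

Lemma l2_integrable f g : mu.-integrable D (EFin \o (f \* g)).
Proof.
apply: (integrableS measurableT) => //.
by apply/Lfun1_integrable; apply: Lfun2_mul_Lfun1; exact: LfunP.
Qed.

Lemma l2ip_semi_inner : semi_inner l2ip.
Proof.
split.
- by move=> f g; apply: eq_Rintegral => x _; rewrite mulrC.
- move=> f g h; rewrite /l2ip -RintegralD//; try exact: l2_integrable.
  by apply: eq_Rintegral => x _; rewrite mulrDl.
- move=> a f g; rewrite /l2ip -RintegralZl//; try exact: l2_integrable.
  by apply: eq_Rintegral => x _; rewrite mulrA.
- by move=> f; apply: Rintegral_ge0 => x _; rewrite -expr2 sqr_ge0.
Qed.

Lemma l2ip_sqrE f : (l2ip f f)%:E = (\int[mu]_(x in D) (f x ^+ 2)%:E)%E.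
Proof.
rewrite /l2ip /Rintegral fineK; first by under eq_integral do rewrite -expr2.
exact: integrable_fin_num (l2_integrable f f).
Qed.

Lemma measurable_fun_Lfun f : measurable_fun setT f.
Proof. by have /andP[] := LfunP f; rewrite inE. Qed.


(** Fatou with a bound that holds from the index [i] on, the form in which a Cauchy estimate with
    one index fixed provides it. *)
Lemma fatou_limn_le (D' : set T) (F : nat -> T -> R) (G : T -> R) (c : \bar R) i :
  measurable D' -> (forall n, measurable_fun D' (F n)) ->
  (forall n x, D' x -> 0 <= F n x) ->
  (forall x, D' x -> F n x @[n --> \oo] --> G x) ->
  (forall n, (i <= n)%N -> (\int[mu]_(x in D') (F n x)%:E <= c)%E) ->
  (\int[mu]_(x in D') (G x)%:E <= c)%E.
Proof.
move=> mD' mF F0 FG Fc.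
have -> : (\int[mu]_(x in D') (G x)%:E =
    \int[mu]_(x in D') limn_einf (fun n => (F n x)%:E))%E.
  apply: eq_integral => x /[!inE] D'x.
  have : (F n x)%:E @[n --> \oo] --> (G x)%:E.
    by apply: cvg_EFin; [exact: nearW|exact: FG].
  by move=> /cvg_limn_einf_sup[-> _].
apply: (le_trans (fatou mu mD' _ _)).
- by move=> n; exact/measurable_EFinP.
- by move=> n x D'x; rewrite lee_fin F0.
rewrite limn_einf_lim; apply: lime_le; first exact: is_cvg_einfs.
apply: nearW => n; apply: le_trans (Fc (maxn i n) (leq_maxl _ _)).
by apply: ereal_inf_lbound; exists (maxn i n) => //=; rewrite leq_maxr.
Qed.

(** Riesz-Fischer for a fast sequence. With weights [4 ^+ i] the squared increments have integrals
    at most [2^-1 ^+ i], so their sum [S] is finite almost everywhere; where it is, the increments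
    are dominated by [Num.sqrt (S x) * 2^-1 ^+ i] and the sequence converges. *)
Lemma L2_complete_aux (v : nat -> L2) :
  (forall i j, (i <= j)%N -> l2ip (v i - v j) (v i - v j) <= (8^-1 ^+ i)) ->
  exists u : L2, forall i, l2ip (v i - u) (v i - u) <= 8^-1 ^+ i.
Proof.
move=> H; have mv i : measurable_fun D (v i).
  exact: measurable_funS (measurable_fun_Lfun (v i)).
pose s i x := 4 ^+ i * (v i x - v i.+1 x) ^+ 2.
have ms i : measurable_fun D (EFin \o s i).
  apply/measurable_EFinP; apply: measurable_funM => //.
  by apply: measurable_funX; apply: measurable_funB.
have s0 i x : D x -> (0 <= (EFin \o s i) x)%E.
  by move=> _; rewrite /= lee_fin mulr_ge0 ?sqr_ge0 ?exprn_ge0.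
pose S x := (\sum_(i <oo) (EFin \o s i) x)%E.
have intS : (\int[mu]_(x in D) S x < +oo)%E.
  rewrite integral_nneseries//.
  apply: (@le_lt_trans _ _ 2%:E)%E; last by rewrite ltry.
  apply: lime_le.
    by apply: is_cvg_nneseries => i _ _; exact: integral_ge0 (s0 i).
  apply: nearW => n; apply: (@le_trans _ _ (\sum_(0 <= i < n) ((2^-1 ^+ i)%:E : \bar R))%E).
    apply: lee_sum => i _.
    have -> : (\int[mu]_(x in D) (EFin \o s i) x)%E =
      ((4 ^+ i)%:E * \int[mu]_(x in D) ((v i - v i.+1) x ^+ 2)%:E)%E.
      rewrite -ge0_integralZl_EFin//.
      - by move=> x _; rewrite lee_fin sqr_ge0.
      - apply/measurable_EFinP; apply: measurable_funX.
        exact: measurable_funS (measurable_fun_Lfun _).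
    rewrite -l2ip_sqrE -EFinM lee_fin.
    have -> : 2^-1 = 4 * 8^-1 :> R by field.
    by rewrite exprMn ler_wpM2l ?exprn_ge0// H.
  rewrite sumEFin lee_fin.
  have -> : \sum_(0 <= i < n) 2^-1 ^+ i = 2 - 2 * 2^-1 ^+ n :> R.
    elim: n => [|n IH]; first by rewrite big_nil expr0; lra.
    by rewrite big_nat_recr//= IH exprS; lra.
  by rewrite gerDl oppr_le0 mulr_ge0// exprn_ge0.
have mS : measurable_fun D S.
  have h := ge0_emeasurable_sum (P := xpredT) (D := D) (h := fun i => EFin \o s i).
  by apply: h => [k x ? _|k _]; [exact: s0|exact: ms].
have [N [mN N0 NS]] : {ae mu, forall x, D x -> S x \is a fin_num}.
  apply: integrable_ae => //; apply/integrableP; split => //.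
  under eq_integral => x /[!inE] Dx.
    rewrite gee0_abs; last by apply: nneseries_ge0 => i _ _; exact: s0.
    over.
  exact: intS.
pose E := D `\` N; have mE : measurable E by exact: measurableD.
have cvgv x : E x -> cvgn (fun i => v i x).
  move=> [Dx Nx].
  have Sx : S x \is a fin_num.
    by apply/negPn/negP => Sx; apply: Nx; apply: NS => /= /(_ Dx); exact/negP.
  pose M := fine (S x).
  have sM i : s i x <= M.
    rewrite -lee_fin fineK//.
    apply: le_trans (nneseries_lim_ge i.+1 _) => [|k _ _]; last exact: s0.
    rewrite big_nat_recr//= leeDr// sume_ge0// => k _; exact: s0.
  have M0 : 0 <= M by apply: le_trans (sM 0%N); rewrite -lee_fin; exact: s0.
  have vM i : `|v i.+1 x - v i x| <= geometric (Num.sqrt M) 2^-1 i.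
    rewrite /= distrC -(@ler_pXn2r _ 2)// ?nnegrE ?mulr_ge0 ?exprn_ge0 ?sqrtr_ge0//.
    rewrite exprMn sqr_sqrtr// real_normK ?num_real// -exprM mulnC exprM.
    rewrite exprVn exprVn ler_pdivlMr ?exprn_gt0// mulrC.
    by rewrite (_ : 2 ^+ 2 = 4 :> R); [exact: sM|ring].
  have c : cvgn (series (fun i => v i.+1 x - v i x)).
    apply: normed_cvg; apply: (series_le_cvg (v_ := geometric (Num.sqrt M) 2^-1)) => //.
    - by move=> k; exact: normr_ge0.
    - by move=> k /=; rewrite mulr_ge0 ?exprn_ge0 ?sqrtr_ge0.
    - by apply: is_cvg_geometric_series; rewrite gtr0_norm ?invf_lt1 ?ltr1n.
  have -> : (fun i => v i x) = (fun i => v 0%N x + series (fun i => v i.+1 x - v i x) i).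
    apply/funext => i; elim: i => [|i IH]; first by rewrite /series/= big_nil addr0.
    by rewrite /series/= big_nat_recr//= addrA -IH addrC subrK.
  by apply: is_cvgD => //; exact: is_cvg_cst.
(* Cutting off outside the convergence set [E] makes the sequence converge everywhere, so that the
   limit is measurable on the whole space. *)
pose u0 x := limn (fun i => (v i \_ E) x).
have vE x : E x -> (fun i => (v i \_ E) x) = (fun i => v i x).
  by move=> Ex; apply/funext => i; rewrite patchE mem_set.
have vN x : ~ E x -> (fun i => (v i \_ E) x) = cst 0.
  by move=> Ex; apply/funext => i; rewrite patchE memNset.
have u0E x : E x -> u0 x = limn (fun i => v i x) by move=> Ex; rewrite /u0 vE.
have u0N x : ~ E x -> u0 x = 0 by move=> Ex; rewrite /u0 vN// lim_cst.
have mvE i : measurable_fun setT (v i \_ E).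
  by apply/(measurable_restrictT _ mE); apply: measurable_funS (mv i) => //; exact: subDsetl.
have cvgE x : (v i \_ E) x @[i --> \oo] --> u0 x.
  have [Ex|Ex] := pselect (E x).
    by rewrite u0E// vE//; exact: cvgv.
  by rewrite u0N// vN//; exact: cvg_cst.
have mu0 : measurable_fun setT u0 by apply: measurable_fun_cvg mvE _ => x _.
have DE (f : T -> R) : measurable_fun setT f ->
    (\int[mu]_(x in D) (f x ^+ 2)%:E = \int[mu]_(x in E) (f x ^+ 2)%:E)%E.
  move=> mf; apply: ge0_negligible_integral => //.
  - apply/measurable_EFinP; apply: measurable_funX; exact: measurable_funS mf.
  - by move=> x _; rewrite lee_fin sqr_ge0.
have key i : (\int[mu]_(x in E) ((v i x - u0 x) ^+ 2)%:E <= (8^-1 ^+ i)%:E)%E.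
  apply: (@fatou_limn_le _ (fun n x => (v i x - v n x) ^+ 2) _ _ i) => //.
  - move=> n; apply: measurable_funX; apply: measurable_funB;
    by apply: measurable_funS (mv _) => //; exact: subDsetl.
  - by move=> n x _; exact: sqr_ge0.
  - move=> x Ex; rewrite u0E//; apply: cvgM; apply: cvgB;
      by [exact: cvg_cst|exact: cvgv].
  - move=> n leqin; rewrite -(DE (v i - v n)); last exact: measurable_fun_Lfun.
    by rewrite -l2ip_sqrE lee_fin H.
have u0L : u0 \in Lfun mu 2%:E.
  apply: Lfun2P => //.
  have -> : (\int[mu]_x (u0 x ^+ 2)%:E = \int[mu]_(x in E) (u0 x ^+ 2)%:E)%E.
    rewrite [RHS]integral_mkcond; apply: eq_integral => x _.
    rewrite patchE; case: ifPn => //; rewrite notin_setE => Ex.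
    by rewrite u0N// expr0n.
  have mE2 (f : T -> R) : measurable_fun setT f ->
      measurable_fun E (fun x => (f x ^+ 2)%:E).
    move=> mf; apply/measurable_EFinP; apply: measurable_funX.
    exact: measurable_funS mf.
  have mvu : measurable_fun setT (fun x => v 0%N x - u0 x).
    by apply: measurable_funB => //; exact: measurable_fun_Lfun.
  apply: (@le_lt_trans _ _ (\int[mu]_(x in E)
     (2%:E * ((v 0%N x - u0 x) ^+ 2)%:E + 2%:E * (v 0%N x ^+ 2)%:E))%E).
    apply: ge0_le_integral => //.
    - by move=> x _; rewrite lee_fin sqr_ge0.
    - exact: mE2.
    - apply: emeasurable_funD; apply: emeasurable_funM => //;
        [exact: (mE2 _ mvu)|apply: (mE2 (v 0%N))].
      exact: measurable_fun_Lfun.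
    - move=> x _; rewrite -!EFinM -EFinD lee_fin.
      by have := sqr_ge0 (2 * v 0%N x - u0 x); lra.
  rewrite ge0_integralD//; last first.
  - by apply: emeasurable_funM => //; apply: (mE2 (v 0%N)); exact: measurable_fun_Lfun.
  - by move=> x _; rewrite -EFinM lee_fin mulr_ge0// sqr_ge0.
  - by apply: emeasurable_funM => //; exact: (mE2 _ mvu).
  - by move=> x _; rewrite -EFinM lee_fin mulr_ge0// sqr_ge0.
  rewrite !ge0_integralZl_EFin//; try by [move=> x _; rewrite lee_fin sqr_ge0
    | exact: (mE2 _ mvu) | apply: (mE2 (v 0%N)); exact: measurable_fun_Lfun].
  apply: lte_add_pinfty; apply: lte_mul_pinfty => //.
    exact: le_lt_trans (key 0%N) (ltry _).
  by rewrite -(DE (v 0%N)) ?ltry -?l2ip_sqrE ?ltry//; exact: measurable_fun_Lfun.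
exists (Lfun_Sub le1_2 u0L) => i.
by rewrite -lee_fin l2ip_sqrE (DE _ (measurable_fun_Lfun _)); exact: key.
Qed.

Lemma l2ip_complete : ip_complete l2ip.
Proof.
have sP := l2ip_semi_inner.
(* The rate [3^-1 ^+ j] has squares below [8^-1 ^+ j], as the fast case asks; in the end it and the
   square root of [8^-1 ^+ j] are both below [2^-1 ^+ j]. *)
move=> u_ cau; have /choice[K KP] : forall j, exists k0, forall k l,
    (k0 <= k)%N -> (k0 <= l)%N -> ipnorm l2ip (u_ k - u_ l) <= 3^-1 ^+ j.
  by move=> j; apply: cau; rewrite exprn_gt0.
(* A running maximum, so that [kap i] and every later [kap j] are beyond the threshold [K i]. *)
pose kap j := (\max_(i < j.+1) K i)%N.
have Kkap i j : (i <= j)%N -> (K i <= kap j)%N.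
  by move=> ij; exact: (leq_bigmax (F := fun i : 'I_j.+1 => K i) (Ordinal (ij : (i < j.+1)%N))).
have [u uP] : exists u : L2, forall i, l2ip (u_ (kap i) - u) (u_ (kap i) - u) <= 8^-1 ^+ i.
  apply: L2_complete_aux => i j ij.
  have := KP i _ _ (Kkap i i (leqnn i)) (Kkap i j ij).
  rewrite -(ipnorm_sqr sP) => h.
  apply: (@le_trans _ _ ((3^-1 ^+ i) ^+ 2)).
    by rewrite ler_pXn2r// ?nnegrE ?ipnorm_ge0 ?exprn_ge0.
  by rewrite -exprM mulnC exprM lerXn2r// ?nnegrE; lra.
exists u => e e0.
have [j je] : exists j, 2 * (2^-1 ^+ j) <= e.
  have cv : (fun k => 2 * 2^-1 ^+ k : R) @ \oo --> (0 : R).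
    rewrite -[X in _ --> X](mulr0 2); apply: cvgMr; apply: cvg_expr.
    by rewrite gtr0_norm ?invf_lt1 ?ltr1n.
  have /cvgrPdist_le/(_ _ e0)[k0 _ k0P] := cv.
  exists k0; have := k0P _ (leqnn k0); rewrite /= sub0r normrN ger0_norm ?mulr_ge0 ?exprn_ge0//.
exists (K j) => k Kk; apply: le_trans je.
apply: le_trans (ipnorm_split sP _ (u_ (kap j)) _) _.
rewrite [leRHS]mulr_natl [leRHS]mulr2n lerD//.
  apply: le_trans (KP j _ _ Kk (Kkap _ _ (leqnn j))) _.
  by rewrite lerXn2r// ?nnegrE; lra.
rewrite -(@ler_pXn2r _ 2)// ?nnegrE ?ipnorm_ge0 ?exprn_ge0// ipnorm_sqr//.
apply: le_trans (uP j) _.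
by rewrite -exprM mulnC exprM lerXn2r// ?nnegrE; lra.
Qed.

End L2.

(** * Lebesgue measure on row vectors and the Poincare inequality *)

Section geometry.
Context {R : realType}.

Lemma measurable_coord_preimage n (i : 'I_n) (B : set R) : measurable B ->
  measurable [set x : 'rV[R]_n | B (x 0 i)].
Proof.
move=> mB; rewrite (_ : [set _ | _] = setT `&` (fun x : 'rV[R]_n => x 0 i) @^-1` B).
  by apply: (@measurable_coord _ (measurableTypeR R) n i).
by rewrite setTI.
Qed.

Lemma measurable_forall_coord n (B : 'I_n -> set R) :
  (forall i, measurable (B i)) ->
  measurable [set x : 'rV[R]_n | forall i, B i (x 0 i)].
Proof.
move=> mB.
have -> : [set x : 'rV[R]_n | forall i, B i (x 0 i)] =
    \bigcap_(i in [set: 'I_n]) [set x | B i (x 0 i)].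
  by apply/seteqP; split=> x /= Bx i; [move=> _|]; exact: Bx.
by apply: fin_bigcap_measurable => // i _; exact: measurable_coord_preimage.
Qed.

(** The sigma-algebra is generated by the coordinates, so boxes are measurable, and [U] is the
    countable union of the boxes with rational centre and radius [k.+1%:R^-1] that it contains; the
    other boxes are replaced by [set0]. *)
Lemma open_measurable_rV n (U : set 'rV[R]_n) : open U -> measurable U.
Proof.
move=> oU.
pose B (z : 'rV[rat]_n * nat) := [set x : 'rV[R]_n |
  forall i, ball (ratr (z.1 0 i) : R) (z.2.+1%:R^-1) (x 0 i)].
pose F z := if pselect (B z `<=` U) then B z else set0.
have -> : U = \bigcup_z F z.
  apply/seteqP; split=> [x Ux|x [z _]]; last first.
    by rewrite /F; case: pselect => // BU; exact: BU.
  have /nbhs_ballP[e /= e0 eU] := open_nbhs_nbhs (conj oU Ux).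
  have [k ke] : exists k : nat, k.+1%:R^-1 + k.+1%:R^-1 <= e.
    exists (Num.truncn (e / 2)^-1).
    have : (Num.truncn (e / 2)^-1).+1%:R^-1 <= e / 2.
      rewrite -[leRHS]invrK lef_pV2 ?posrE ?invr_gt0 ?divr_gt0//.
      exact/ltW/truncnS_gt.
    by move: (_^-1) => r; lra.
  have k0 : 0 < k.+1%:R^-1 :> R by rewrite invr_gt0.
  have /choice[q qP] : forall i : 'I_n, exists q : rat,
      ball (ratr q : R) k.+1%:R^-1 (x 0 i).
    move=> i; have [q] := @rat_in_itvoo R (x 0 i - k.+1%:R^-1) (x 0 i) ltac:(by rewrite gtrBl).
    rewrite in_itv/= => /andP[q1 q2]; exists q.
    by rewrite /ball/= ler0_norm ?subr_le0 1?ltW// opprB ltrBlDr addrC -ltrBlDr.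
  exists (\row_i q i, k) => //; rewrite /F; case: pselect => [_ i|]; first by rewrite mxE.
  case=> y By; apply: eU; split => // i j; rewrite ord1.
  apply: (le_ball ke); have := By j; rewrite /= mxE; apply: ball_triangle.
  exact/ball_sym.
apply: countable_bigcupT_measurable => [|z]; first exact: countableP.
rewrite /F; case: pselect => [?|?]; last exact: measurable0.
apply: (@measurable_forall_coord n (fun i => ball (ratr (z.1 0 i) : R) z.2.+1%:R^-1)).
by move=> i; exact: measurable_ball.
Qed.

Lemma continuous_measurable_rV n (f : 'rV[R]_n -> R) : continuous f ->
  measurable_fun setT f.
Proof.
move=> /continuousP cf; apply: (measurability _ (RGenOpens.measurableE R)) => //.
move=> _ [_ [a [b ->]] <-]; rewrite setTI.
by apply: open_measurable_rV; apply: cf; exact: interval_open.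
Qed.

Definition box_rV n (M : R) : set 'rV[R]_n := [set x | forall i, `|x 0 i| <= M].
Arguments box_rV : clear implicits.

Lemma normr_le_itv (M : R) : [set x : R | `|x| <= M] = [set` `[- M, M]].
Proof. by apply/seteqP; split=> x /=; rewrite in_itv/= ler_norml. Qed.

Lemma measurable_box_rV n (M : R) : measurable (box_rV n M).
Proof.
apply: (@measurable_forall_coord n (fun=> [set x : R | `|x| <= M])) => _.
by rewrite normr_le_itv; exact: measurable_itv.
Qed.

Lemma lebesgue_box_rV n (M : R) : (lebesgue_rV R n (box_rV n M) < +oo)%E.
Proof.
elim: n => [|n IH].
  apply: (@le_lt_trans _ _ (lebesgue_rV R 0 setT)); last by rewrite /= diracT ltry.
  by apply: le_measure; rewrite ?inE//; exact: measurable_box_rV.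
rewrite /= /lebesgue_cons /pushforward.
have -> : @cons_rV R n @^-1` box_rV n.+1 M = [set` `[- M, M]%R] `*` box_rV n M.
  apply/seteqP; split=> [[a x] /= H|[a x] /= []].
    split; last by move=> i; have := H (lift ord0 i); rewrite cons_rVS.
    by have := H ord0; rewrite cons_rV0 in_itv/= ler_norml.
  rewrite in_itv/= -ler_norml => Ma Mx i; have [->|] := eqVneq i ord0.
    by rewrite cons_rV0.
  by rewrite eq_sym => /unlift_some[j -> _]; rewrite cons_rVS.
rewrite product_measure1E//; last exact: measurable_box_rV.
apply: lte_mul_pinfty => //; rewrite ge0_fin_numE//.
have := @lebesgue_measure_itv R `[- M, M] => /= E.
by rewrite [X in (X < _)%E]E; case: ifPn => _; rewrite ?ltry.
Qed.

Lemma bounded_set_box n (A : set 'rV[R]_n) : bounded_set A ->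
  exists2 M, 0 < M & A `<=` box_rV n M.
Proof.
move=> [M [_ bM]]; exists (`|M| + 1); first by rewrite ltr_wpDl.
move=> x /(bM (`|M| + 1) (ltr_pwDr ltr01 (ler_norm M))) /= xM i.
apply: le_trans xM; rewrite [leRHS](mx_normrE x).
exact: (le_bigmax_cond 0 (fun ij : 'I_1 * 'I_n => `|x ij.1 ij.2|) (j := (0, i)) isT).
Qed.

Lemma bounded_measure_lty n (A : set 'rV[R]_n) : measurable A -> bounded_set A ->
  (lebesgue_rV R n A < +oo)%E.
Proof.
move=> mA /bounded_set_box[M M0 AM]; apply: le_lt_trans (lebesgue_box_rV n M).
by apply: le_measure; rewrite ?inE//; exact: measurable_box_rV.
Qed.

(** Tonelli with the first coordinate as inner variable, ready for a one-dimensional inequality on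
    each slice. *)
Lemma integral_cons_rV n (f : 'rV[R]_n.+1 -> \bar R) : measurable_fun setT f ->
  (forall z, 0 <= f z)%E ->
  (\int[lebesgue_rV R n.+1]_z f z =
   \int[lebesgue_rV R n]_x \int[@lebesgue_measure R]_s f (cons_rV (s, x)))%E.
Proof.
move=> mf f0.
rewrite (ge0_integral_pushforward (@measurable_cons_rV R n))// preimage_setT.
rewrite fubini_tonelli2//; last by move=> z; exact: f0.
by apply: measurableT_comp => //; exact: measurable_cons_rV.
Qed.

(* Integrating [(s * psi^2)' = psi^2 + 2 s psi psi'] over [-M, M] gives 0. *)
Lemma poincare_R (psi : R -> R) (M : R) : 0 < M ->
  (forall s, derivable psi s 1) -> continuous (derive1 psi) ->
  (forall s, M <= `|s| -> psi s = 0) ->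
  (\int[lebesgue_measure]_s (psi s ^+ 2)%:E <=
   (4 * M ^+ 2)%:E * \int[lebesgue_measure]_s (derive1 psi s ^+ 2)%:E)%E.
Proof.
move=> M0 dpsi cdpsi psi0.
have NMM : - M < M by lra.
have cpsi : continuous psi.
  by move=> s; apply/differentiable_continuous/derivable1_diffP.
pose F s := s * psi s ^+ 2.
pose f s := psi s ^+ 2 + 2 * (s * psi s * derive1 psi s).
have dF (s : R) : is_derive s (1 : R) F (f s).
  have h : is_derive s (1 : R) psi (derive1 psi s) by rewrite derive1E; exact: derivableP.
  have h2 : is_derive s (1 : R) (fun s => psi s ^+ 2) (2 * (psi s * derive1 psi s)).
    have := is_deriveM h h; rewrite (_ : psi * psi = (fun s => psi s ^+ 2)).
      by move=> /is_derive_eq; apply; rewrite /GRing.scale/=; ring.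
    by apply/funext => x; rewrite expr2.
  have := is_deriveM (is_derive_id s 1) h2.
  by move=> /is_derive_eq; apply; rewrite /GRing.scale/= /f; ring.
have cF : continuous F.
  by move=> s; apply: cvgM => //; apply: cvgM; exact: cpsi.
have cf : continuous f.
  move=> s; apply: cvgD; first by apply: cvgM; exact: cpsi.
  apply: cvgM; first exact: cvg_cst.
  by apply: cvgM; [apply: cvgM => //; exact: cpsi|exact: cdpsi].
have mI : measurable [set` `[-M, M]] by exact: measurable_itv.
pose I := [set` `[- M, M]].
have cdpsi2 : continuous (fun s => derive1 psi s ^+ 2).
  by move=> s; apply: cvgM; exact: cdpsi.
have FTC : (\int[lebesgue_measure]_(s in I) (f s)%:E = 0)%E.
  rewrite (@continuous_FTC2 R f F)//.
  - rewrite /F psi0; last by rewrite ger0_norm// ltW.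
    rewrite psi0; last by rewrite normrN ger0_norm// ltW.
    by rewrite expr0n/= !mulr0 subee.
  - exact: continuous_subspaceT.
  - split.
    + by move=> s _; have [] := dF s.
    + by apply: cvg_at_right_filter; exact: cF.
    + by apply: cvg_at_left_filter; exact: cF.
  - by move=> s _; rewrite derive1E; have [] := dF s.
have intc (h : R -> R) : continuous h ->
    (@lebesgue_measure R).-integrable I (EFin \o h).
  move=> ch; apply: continuous_compact_integrable; first exact: segment_compact.
  exact: continuous_subspaceT.
apply: (@le_trans _ _ (\int[lebesgue_measure]_(s in I) (psi s ^+ 2)%:E)%E).
  rewrite [leRHS]integral_mkcond le_eqVlt; apply/orP; left; apply/eqP.
  apply: eq_integral => s _; rewrite patchE; case: ifPn => // /negP sI.
  rewrite psi0 ?expr0n// leNgt; apply/negP => sM; apply: sI.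
  by rewrite mem_setE /= in_itv/= -ler_norml ltW.
(* The integrands compare pointwise: the right one minus [psi s ^+ 2] is at least
   [(psi s + 2 * s * psi' s) ^+ 2], because [s ^+ 2 <= M ^+ 2] on the interval. *)
apply: (@le_trans _ _ (\int[lebesgue_measure]_(s in I)
    (2%:E * (f s)%:E + (4 * M ^+ 2)%:E * (derive1 psi s ^+ 2)%:E))%E).
  apply: ge0_le_integral => //.
  - by move=> s _; rewrite lee_fin sqr_ge0.
  - apply/measurable_EFinP; apply: measurable_funS (continuous_measurable_fun _) => //.
    by move=> s; apply: cvgM; exact: cpsi.
  - apply: emeasurable_funD; apply: emeasurable_funM => //.
      by apply/measurable_EFinP; apply: measurable_funS (continuous_measurable_fun cf).
    by apply/measurable_EFinP; apply: measurable_funS (continuous_measurable_fun cdpsi2).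
  - move=> s Is; have sM : `|s| <= M by move: Is; rewrite /I /= in_itv/= -ler_norml.
    rewrite -!EFinM -EFinD lee_fin /f.
    have : s ^+ 2 <= M ^+ 2 by rewrite -[leLHS]real_normK ?num_real// ler_pXn2r// ?nnegrE// ltW.
    move=> /(ler_wpM2r (sqr_ge0 (2 * derive1 psi s))).
    have := sqr_ge0 (psi s + 2 * s * derive1 psi s). nra.
rewrite integralD//; last 2 first.
- by apply: integrableZl => //; exact: intc.
- by apply: integrableZl => //; exact: (intc _ cdpsi2).
rewrite integralZl//; last exact: intc.
rewrite FTC mule0 add0e integralZl//; last exact: (intc _ cdpsi2).
apply: lee_wpmul2l; first by rewrite lee_fin mulr_ge0// sqr_ge0.
apply: ge0_subset_integral => //.
- by apply/measurable_EFinP; exact: continuous_measurable_fun.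
- by move=> s _; rewrite lee_fin sqr_ge0.
Qed.

End geometry.
Arguments box_rV {R} n M.

(** * Test functions: linearity, derivatives, boundedness *)

Section test_functions.
Context {R : realType} {m : nat}.
Implicit Types (f g phi : 'rV[R]_m -> R) (Omega : set 'rV[R]_m).

Lemma smooth_partial i phi : smooth phi -> smooth (partial i phi).
Proof. by move=> sphi s x; have := sphi (rcons s i) x; rewrite foldr_rcons. Qed.

Lemma smooth_continuous phi : smooth phi -> continuous phi.
Proof. by move=> sphi x; apply: differentiable_continuous; exact: (sphi [::]). Qed.

Lemma smooth_derivable phi x v : smooth phi -> derivable phi x v.
Proof. by move=> sphi; apply: diff_derivable; exact: (sphi [::]). Qed.

Lemma partial_lin (a : R) i f g : smooth f -> smooth g ->
  partial i (fun x => a * f x + g x) = fun x => a * partial i f x + partial i g x.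
Proof.
move=> sf sg; apply/funext => x; rewrite /partial.
have -> : (fun x => a * f x + g x) = (a \*: f) + g by apply/funext.
rewrite deriveD ?deriveZ//; first exact: smooth_derivable.
- by apply: derivableZ; exact: smooth_derivable.
- exact: smooth_derivable.
Qed.

Lemma smooth_lin (a : R) f g : smooth f -> smooth g ->
  smooth (fun x => a * f x + g x).
Proof.
move=> sf sg s x.
have -> : foldr partial (fun x => a * f x + g x) s =
    fun x => a * foldr partial f s x + foldr partial g s x.
  elim: s => [//|i s IH] /=; rewrite IH partial_lin//.
    by move=> s'; rewrite -foldr_cat; exact: sf.
  by move=> s'; rewrite -foldr_cat; exact: sg.
have -> : (fun x => a * foldr partial f s x + foldr partial g s x) =
   (a \*: foldr partial f s) + foldr partial g s by apply/funext.
by apply: differentiableD; [apply: differentiableZ; exact: sf|exact: sg].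
Qed.

Lemma test_function_lin Omega (a : R) f g : test_function Omega f ->
  test_function Omega g -> test_function Omega (fun x => a * f x + g x).
Proof.
move=> [sf [K [cK KO Kf]]] [sg [L [cL LO Lg]]]; split; first exact: smooth_lin.
exists (K `|` L); split; first exact: compactU.
  by move=> x [/KO|/LO].
move=> x /not_orP[Kx Lx]; by rewrite Kf// Lg// mulr0 addr0.
Qed.

Lemma test_function0 Omega : test_function Omega (fun=> 0).
Proof.
split; last by exists set0; split => //; exact: compact0.
move=> s x; have -> : foldr partial (fun=> 0) s = cst 0 :> ('rV[R]_m -> R).
  elim: s => //= i s ->; apply/funext => y; exact: derive_cst.
exact: differentiable_cst.
Qed.

Lemma test_function_partial Omega i phi : test_function Omega phi ->
  test_function Omega (partial i phi).
Proof.
move=> [sphi [K [cK KO Kphi]]]; split; first exact: smooth_partial.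
exists K; split => // x Kx.
have oK : open (~` K).
  by apply: closed_openC; apply: compact_closed => //; exact: norm_hausdorff.
have : {near x, phi =1 cst 0}.
  by apply: filterS (open_nbhs_nbhs (conj oK Kx)) => y /Kphi.
by move=> /(near_eq_derive (delta_mx 0 i)); rewrite /partial => ->; exact: derive_cst.
Qed.

Lemma test_function_measurable Omega phi : test_function Omega phi ->
  measurable_fun setT phi.
Proof. by move=> [sphi _]; exact: (continuous_measurable_rV (smooth_continuous sphi)). Qed.

Lemma test_function_bounded Omega phi : test_function Omega phi ->
  exists B : R, forall x, `|phi x| <= B.
Proof.
move=> [sphi [K [cK _ Kphi]]].
have : compact (phi @` K).
  by apply: continuous_compact => //; apply/continuous_subspaceT/smooth_continuous.
move=> /compact_bounded[M [_ bM]]; exists (`|M| + 1) => x.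
have [Kx|/Kphi->] := pselect (K x); last by rewrite normr0 addr_ge0.
by apply: (bM _ (ltr_pwDr ltr01 (ler_norm M))); exists x.
Qed.

Lemma test_function_out Omega phi x : test_function Omega phi -> ~ Omega x ->
  phi x = 0.
Proof. by move=> [_ [K [_ KO Kphi]]] Ox; apply: Kphi => /KO. Qed.

End test_functions.

(** * The Poincare inequality by slicing along the first axis *)

Section poincare.
Context {R : realType} {n : nat}.

Lemma cons_rV_shift (h s : R) (x : 'rV[R]_n) :
  cons_rV (h *: (1 : R) + s, x) = h *: delta_mx 0 ord0 + cons_rV (s, x).
Proof.
apply/rowP => i; rewrite [RHS]mxE [X in _ = X + _]mxE [delta_mx _ _ _ _]mxE eqxx.
have [->|i0] := eqVneq i ord0; first by rewrite !cons_rV0.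
rewrite mulr0 add0r; move: i0.
by rewrite eq_sym => /unlift_some[j -> _]; rewrite !cons_rVS.
Qed.

Lemma slice_quotient (phi : 'rV[R]_n.+1 -> R) (s : R) (x : 'rV[R]_n) :
  (fun h : R => h^-1 *: (phi (h *: delta_mx 0 ord0 + cons_rV (s, x)) -
     phi (cons_rV (s, x)))) =
  (fun h : R => h^-1 *: (phi (cons_rV (h *: (1 : R) + s, x)) - phi (cons_rV (s, x)))).
Proof. by apply/funext => h; rewrite cons_rV_shift. Qed.

Lemma derivable_slice (phi : 'rV[R]_n.+1 -> R) (s : R) (x : 'rV[R]_n) :
  smooth phi -> derivable (fun s : R => phi (cons_rV (s, x))) s 1.
Proof.
move=> sphi; have := @smooth_derivable _ _ phi (cons_rV (s, x)) (delta_mx 0 ord0) sphi.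
by rewrite /derivable /= slice_quotient.
Qed.

Lemma derive1_slice (phi : 'rV[R]_n.+1 -> R) (x : 'rV[R]_n) :
  derive1 (fun s : R => phi (cons_rV (s, x))) =
  (fun s => partial ord0 phi (cons_rV (s, x))).
Proof.
apply/funext => s; rewrite derive1E /partial /derive /=.
by rewrite slice_quotient.
Qed.

Lemma continuous_cons_rV (x : 'rV[R]_n) : continuous (fun s : R => cons_rV (s, x)).
Proof.
move=> s; apply/cvg_ballP => e e0.
near=> t; split => // i j; rewrite ord1.
have [->|] := eqVneq j ord0; first by rewrite !cons_rV0; near: t; apply: (@nbhsx_ballx R R^o s e e0).
rewrite eq_sym => /unlift_some[k -> _]; rewrite !cons_rVS; exact: ballxx.
Unshelve. all: by end_near. Qed.

(** The one-dimensional inequality on each line parallel to the first axis, with [M + 1] for [M]: a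
    slice must vanish from the bound on, including at it, while the box containing [Omega] is
    closed. This gives [C = 2 * (M + 1)]. *)
Lemma poincare_rV (Omega : set 'rV[R]_n.+1) : bounded_set Omega ->
  exists2 C : R, 0 < C & forall phi, test_function Omega phi ->
  (\int[lebesgue_rV R n.+1]_x (phi x ^+ 2)%:E <=
   (C ^+ 2)%:E * \int[lebesgue_rV R n.+1]_x (partial ord0 phi x ^+ 2)%:E)%E.
Proof.
move=> /bounded_set_box[M M0 OM]; exists (2 * (M + 1)) => [|phi tphi].
  by lra.
have mphi2 (f : 'rV[R]_n.+1 -> R) : test_function Omega f ->
    measurable_fun setT (fun x => (f x ^+ 2)%:E).
  move=> tf; apply/measurable_EFinP; apply: measurable_funX.
  exact: test_function_measurable tf.
have mslice (f : 'rV[R]_n.+1 -> R) : test_function Omega f ->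
    measurable_fun setT (fun x : 'rV[R]_n =>
      \int[@lebesgue_measure R]_s (f (cons_rV (s, x)) ^+ 2)%:E)%E.
  move=> tf; apply: (measurable_fun_fubini_tonelli_G (m1 := @lebesgue_measure R)
    (fun z => (f (cons_rV z) ^+ 2)%:E)).
    by apply: measurableT_comp (mphi2 _ tf) _; exact: measurable_cons_rV.
  by move=> z; rewrite lee_fin sqr_ge0.
have tp := test_function_partial ord0 tphi.
rewrite !integral_cons_rV; try by [exact: mphi2|move=> z; rewrite lee_fin sqr_ge0].
have sphi := tphi.1.
have C0 : (0 <= (2 * (M + 1)) ^+ 2) by exact: sqr_ge0.
rewrite -ge0_integralZl_EFin//; last first.
- exact: mslice.
- by move=> x _; apply: integral_ge0 => s _; rewrite lee_fin sqr_ge0.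
apply: ge0_le_integral => //.
- by move=> x _; apply: integral_ge0 => s _; rewrite lee_fin sqr_ge0.
- exact: mslice.
- by apply: emeasurable_funM => //; exact: mslice.
move=> x _; rewrite exprMn (_ : 2 ^+ 2 = 4 :> R); last by ring.
have M1 : 0 < M + 1 by lra.
have := @poincare_R R (fun s => phi (cons_rV (s, x))) (M + 1) M1.
rewrite derive1_slice; apply.
- by move=> s; exact: derivable_slice.
- move=> s; apply: continuous_comp; first exact: continuous_cons_rV.
  by apply: smooth_continuous; exact: tp.1.
- move=> s sM; apply: (test_function_out tphi) => /OM /(_ ord0).
  by rewrite cons_rV0; lra.
Qed.

End poincare.

(** * ReLU networks *)

Section networks.
Context {R : realType} {m : nat}.
Implicit Types (x : 'rV[R]_m) (y s t : R).

Lemma ler_dist_relu (a b : R) : `|relu a - relu b| <= `|a - b|.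
Proof.
rewrite /relu; case: (leP a 0) => a0; case: (leP b 0) => b0.
- by rewrite subrr normr0.
- by rewrite sub0r normrN gtr0_norm// ler0_norm; lra.
- by rewrite subr0 gtr0_norm// ger0_norm; lra.
- by [].
Qed.

Definition mx_sum_norm k n (W : 'M[R]_(k, n)) : R := \sum_i \sum_j `|W i j|.

Lemma mx_sum_norm_ge0 k n (W : 'M[R]_(k, n)) : 0 <= mx_sum_norm W.
Proof. by apply: sumr_ge0 => i _; apply: sumr_ge0. Qed.

Lemma mulmx_bound k n (W : 'M[R]_(k, n)) (a : 'cV[R]_n) (c : R) i :
  0 <= c -> (forall j, `|a j 0| <= c) -> `|(W *m a) i 0| <= mx_sum_norm W * c.
Proof.
move=> c0 ac; rewrite mxE; apply: le_trans (ler_norm_sum _ _ _) _.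
rewrite /mx_sum_norm (bigD1 i)//= mulrDl mulr_suml; apply: ler_wpDr.
  by rewrite mulr_ge0//; apply: sumr_ge0 => ? _; apply: sumr_ge0.
by apply: ler_sum => j _; rewrite normrM ler_wpM2l.
Qed.

Lemma affineB k n (W : 'M[R]_(k, n)) (a a' : 'cV[R]_n) (b : 'cV[R]_k) i :
  (W *m a + b) i 0 - (W *m a' + b) i 0 = (W *m (a - a')) i 0.
Proof. by rewrite mulmxBr !mxE opprD addrACA subrr addr0. Qed.

Lemma mulmxB_entry k n (W : 'M[R]_(k, n)) (a a' : 'cV[R]_n) i :
  (W *m a) i 0 - (W *m a') i 0 = (W *m (a - a')) i 0.
Proof. by rewrite mulmxBr !mxE. Qed.

Lemma first_layerE k (W : 'M[R]_(k, m + 1)) (b : 'cV[R]_k) x y i :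
  net_eval (FirstLayer W b) x y i 0 =
  \sum_(j < m) W i (lshift 1 j) * x 0 j + W i (rshift m 0) * y + b i 0.
Proof.
rewrite /= mxE; congr (_ + _); rewrite mxE big_split_ord/= big_ord1; congr (_ + _).
  by apply: eq_bigr => j _; rewrite col_mxEu mxE.
by rewrite col_mxEd mxE.
Qed.

Lemma first_derivE sig k (W : 'M[R]_(k, m + 1)) (b : 'cV[R]_k) x y s i :
  net_deriv sig (FirstLayer W b) x y s i 0 = s * W i (rshift m 0).
Proof. by rewrite /= !mxE. Qed.

Lemma ler_mx_sum_norm k n (W : 'M[R]_(k, n)) i j : `|W i j| <= mx_sum_norm W.
Proof.
rewrite /mx_sum_norm (bigD1 i)//= (bigD1 j)//= -addrA lerDl addr_ge0//.
  exact: sumr_ge0.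
by apply: sumr_ge0 => ? _; apply: sumr_ge0.
Qed.

(** The constant is uniform in [x], since [x] and [y] enter the first layer additively and relu is
    1-Lipschitz. *)
Lemma net_eval_lipschitz k (N : relu_net R m k) : exists2 L, 0 <= L &
  forall x y y' i, `|net_eval N x y i 0 - net_eval N x y' i 0| <= L * `|y - y'|.
Proof.
elim: N => [{}k W b|n {}k N [L L0 IH] W b].
  exists (mx_sum_norm W); first exact: mx_sum_norm_ge0.
  move=> x y y' i; rewrite !first_layerE.
  rewrite (_ : _ - _ = W i (rshift m 0) * (y - y')); last by ring.
  by rewrite normrM ler_wpM2r// ler_mx_sum_norm.
exists (mx_sum_norm W * L); first by rewrite mulr_ge0 ?mx_sum_norm_ge0.
move=> x y y' i; rewrite [net_eval _]/= affineB -mulrA.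
apply: mulmx_bound => [|j]; first by rewrite mulr_ge0.
by rewrite !mxE; exact: le_trans (ler_dist_relu _ _) (IH _ _ _ _).
Qed.

Lemma net_eval_bounded k (N : relu_net R m k) (M : R) : exists2 B, 0 <= B &
  forall x, box_rV m M x -> forall i, `|net_eval N x 0 i 0| <= B.
Proof.
have aff k' (b : 'cV[R]_k') i : `|b i 0| <= mx_sum_norm b by exact: ler_mx_sum_norm.
elim: N => [{}k W b|n {}k N [B B0 IH] W b].
  exists (\sum_(j < m) (mx_sum_norm W * `|M|) + mx_sum_norm b).
    rewrite addr_ge0 ?mx_sum_norm_ge0//; apply: sumr_ge0 => j _.
    by rewrite mulr_ge0 ?mx_sum_norm_ge0.
  move=> x xM i; rewrite first_layerE mulr0 addr0.
  apply: le_trans (ler_normD _ _) _; apply: lerD => //.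
  apply: le_trans (ler_norm_sum _ _ _) _; apply: ler_sum => j _.
  rewrite normrM ler_pM// ?ler_mx_sum_norm//.
  exact: le_trans (xM j) (ler_norm M).
exists (mx_sum_norm W * B + mx_sum_norm b).
  by rewrite addr_ge0 ?mulr_ge0 ?mx_sum_norm_ge0.
move=> x xM i; rewrite [net_eval _]/= mxE.
apply: le_trans (ler_normD _ _) _; apply: lerD => //.
apply: mulmx_bound => // j; rewrite mxE.
have := ler_dist_relu (net_eval N x 0 j 0) 0.
by rewrite /relu maxxx !subr0 => /le_trans; apply; exact: IH.
Qed.

(* ReLU networks are piecewise linear, so the difference quotient is eventually
   constant. *)
Lemma net_eval_deriv k (N : relu_net R m k) x y s : exists2 t0 : R, 0 < t0 &
  forall t, 0 <= t -> t <= t0 -> forall i,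
    net_eval N x (y + t * s) i 0 = net_eval N x y i 0 + t * net_deriv relu N x y s i 0.
Proof.
elim: N => [{}k W b|n {}k N [t0 t0_gt0 IH] W b].
  by exists 1 => // t _ _ i; rewrite !first_layerE first_derivE; ring.
(* For [z != 0] the threshold [|z| / (|d| + 1)] keeps [z + t * d] from crossing 0; at [z = 0]
   positive homogeneity of relu makes every threshold good. *)
have step (z d : R) : exists2 t1 : R, 0 < t1 & forall t, 0 <= t -> t <= t1 ->
    relu (z + t * d) = relu z + t * ((0 < z)%R%:R * d + (z == 0)%:R * relu d).
  rewrite /relu; have [z0|z0|->] := ltgtP z 0.
  - exists (- z / (`|d| + 1)) => [|t t_ge0]; first by rewrite divr_gt0 ?oppr_gt0// ltr_wpDl.
    rewrite ler_pdivlMr ?ltr_wpDl// => td.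
    have dd : t * d <= t * `|d| by rewrite ler_wpM2l// ler_norm.
    rewrite (max_idPr _); last by lra.
    by rewrite /=; ring.
  - exists (z / (`|d| + 1)) => [|t t_ge0]; first by rewrite divr_gt0// ltr_wpDl.
    rewrite ler_pdivlMr ?ltr_wpDl// => td.
    have dd : t * (- d) <= t * `|d| by rewrite ler_wpM2l// -normrN ler_norm.
    rewrite (max_idPl _); last by lra.
    by rewrite /=; ring.
  - exists 1 => // t t_ge0 _; rewrite /= ?maxxx !add0r mul0r add0r mul1r.
    by rewrite maxr_pMr// mulr0.
have [t1 t1_gt0 t1P] : exists2 t1 : R, 0 < t1 & forall t, 0 <= t -> t <= t1 ->
    forall j, relu (net_eval N x y j 0 + t * net_deriv relu N x y s j 0) =
    relu (net_eval N x y j 0) + t * ((0 < net_eval N x y j 0)%R%:R *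
      net_deriv relu N x y s j 0 + (net_eval N x y j 0 == 0)%:R *
      relu (net_deriv relu N x y s j 0)).
  have /choice[T TP] : forall j, exists t1 : R, 0 < t1 /\ forall t, 0 <= t -> t <= t1 ->
      relu (net_eval N x y j 0 + t * net_deriv relu N x y s j 0) =
      relu (net_eval N x y j 0) + t * ((0 < net_eval N x y j 0)%R%:R *
      net_deriv relu N x y s j 0 + (net_eval N x y j 0 == 0)%:R *
      relu (net_deriv relu N x y s j 0)).
    by move=> j; have [t1] := step (net_eval N x y j 0) (net_deriv relu N x y s j 0); exists t1.
  exists (\big[Num.min/1]_j T j).
    by apply: lt_bigmin => // j _; exact: (TP j).1.
  move=> t t_ge0 tT j; apply: (TP j).2 => //; apply: le_trans tT _.
  exact: bigmin_le_cond.
exists (Num.min t0 t1) => [|t t_ge0]; first by rewrite lt_min t0_gt0.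
rewrite le_min => /andP[tt0 tt1] i.
rewrite [net_eval _]/= [net_deriv _ _]/= !mxE addrAC; congr (_ + _).
rewrite mulr_sumr -big_split/=; apply: eq_bigr => j _.
by rewrite !mxE IH// t1P//; ring.
Qed.

(** [C] depends on the weights alone. From layer to layer an active unit passes the error on, a unit
    at its kink adds at most [eta] to it because relu is 1-Lipschitz, and an inactive unit removes
    it; hence [C + 1] times the size of the weight matrix. *)
Lemma net_deriv_smoothing k (N : relu_net R m k) : exists2 C, 0 <= C &
  forall (sig : R -> R) (eta : R), 0 <= eta ->
  (forall t, `|sig t - relu t| <= eta) -> forall x y s i,
    `|net_deriv sig N x y s i 0 - net_deriv relu N x y s i 0| <= C * eta.
Proof.
elim: N => [{}k W b|n {}k N [C C0 IH] W b].
  by exists 0 => // sig eta eta0 _ x y s i; rewrite !first_derivE subrr normr0 mul0r.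
exists (mx_sum_norm W * (C + 1)); first by rewrite mulr_ge0 ?mx_sum_norm_ge0 ?addr_ge0.
move=> sig eta eta0 sigP x y s i; rewrite [net_deriv _ _]/= [net_deriv relu _]/=.
rewrite mulmxB_entry -mulrA.
have Ceta : 0 <= C * eta by rewrite mulr_ge0.
apply: mulmx_bound => [|j]; first by rewrite mulr_ge0// addr_ge0.
have := IH sig eta eta0 sigP x y s j; rewrite !mxE.
move: (net_deriv sig _ _ _ _ _ _) (net_deriv relu _ _ _ _ _ _) => d d' dd'.
have h := sigP d; have h' := ler_dist_relu d d'.
have [z0|z0|z0] := ltgtP (net_eval N x y j 0) 0; rewrite /= !(mul0r, mul1r, addr0, add0r).
- by rewrite oppr0 normr0 mulr_ge0 ?addr_ge0.
- by apply: le_trans dd' _; rewrite ler_wpM2r ?lerDl.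
- rewrite (_ : _ - _ = (sig d - relu d) + (relu d - relu d')); last by ring.
  by apply: le_trans (ler_normD _ _) _; rewrite mulrDl mul1r addrC lerD// (le_trans h').
Qed.

Lemma measurable_net_eval k (N : relu_net R m k) (y : 'rV[R]_m -> R) i :
  measurable_fun setT y -> measurable_fun setT (fun x => net_eval N x (y x) i 0).
Proof.
move=> my; elim: N i => [{}k W b|n {}k N IH W b] i.
  under eq_fun do rewrite first_layerE.
  apply: measurable_funD => //; apply: measurable_funD; last exact: measurable_funM.
  apply: measurable_sum => j; apply: measurable_funM => //.
  exact: (@measurable_coord _ (measurableTypeR R) m j).
rewrite [net_eval _]/=.
under eq_fun do rewrite mxE mxE.
apply: measurable_funD => //; apply: measurable_sum => j; apply: measurable_funM => //.
under eq_fun do rewrite mxE.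
by apply: measurable_maxr => //; exact: IH.
Qed.

Lemma measurable_eq0 : measurable_fun setT (fun t : R => (t == 0)%:R : R).
Proof.
rewrite (_ : (fun _ => _) = \1_[set 0]).
  by apply: measurable_indic; exact: measurable_set1.
apply/funext => t; rewrite indicE; congr (nat_of_bool _)%:R.
by apply/idP/idP => [/eqP ->|/set_mem ->]; rewrite ?eqxx ?mem_set.
Qed.

Lemma measurable_net_deriv (sig : R -> R) k (N : relu_net R m k)
    (y s : 'rV[R]_m -> R) i : measurable_fun setT sig ->
  measurable_fun setT y -> measurable_fun setT s ->
  measurable_fun setT (fun x => net_deriv sig N x (y x) (s x) i 0).
Proof.
move=> msig my ms; elim: N i => [{}k W b|n {}k N IH W b] i.
  by under eq_fun do rewrite first_derivE; exact: measurable_funM.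
rewrite [net_deriv _ _]/=.
under eq_fun do rewrite mxE.
apply: measurable_sum => j; apply: measurable_funM => //.
under eq_fun do rewrite mxE.
have mz := measurable_net_eval N j my.
have mpos : measurable_fun setT (fun t : R => (0 < t)%R%:R : R).
  rewrite (_ : (fun _ => _) = \1_[set` `]0, +oo[]).
    by apply: measurable_indic; exact: measurable_itv.
  by apply/funext => t; rewrite indicE mem_setE in_itv/= andbT.
apply: measurable_funD; apply: measurable_funM.
- exact: (measurableT_comp mpos mz).
- exact: IH.
- exact: (measurableT_comp measurable_eq0 mz).
- by apply: measurableT_comp => //; exact: IH.
Qed.

End networks.

(** * Weak solutions as equations in L^2 *)

Section sum_semi_inner.
Context {R : realType} {V : lmodType R} (I : finType) (b : V -> V -> R).
Hypothesis bP : semi_inner b.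

Definition sum_ip (v w : I -> V) : R := \sum_i b (v i) (w i).

Lemma sum_ip_semi_inner : semi_inner sum_ip.
Proof.
split=> [u v|u v w|a u v|u].
- by apply: eq_bigr => i _; rewrite (ipC bP).
- by rewrite -big_split/=; apply: eq_bigr => i _; rewrite (ipDl bP).
- by rewrite /sum_ip mulr_sumr; apply: eq_bigr => i _; rewrite (ipZl bP).
- by apply: sumr_ge0 => i _; exact: ip_ge0.
Qed.

Lemma ipnorm_le_sum (v : I -> V) i : ipnorm b (v i) <= ipnorm sum_ip v.
Proof.
rewrite /ipnorm ler_wsqrtr// /sum_ip (bigD1 i)//= lerDl.
by apply: sumr_ge0 => j _; exact: ip_ge0.
Qed.

Lemma ipnorm_sum_le (v : I -> V) (e : R) : (forall i, ipnorm b (v i) <= e) ->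
  0 <= e -> ipnorm sum_ip v <= #|I|%:R * e.
Proof.
move=> ve e0.
rewrite -(@ler_pXn2r _ 2)// ?nnegrE ?ipnorm_ge0 ?mulr_ge0//.
rewrite (ipnorm_sqr sum_ip_semi_inner).
apply: (@le_trans _ _ (\sum_(i : I) e ^+ 2)).
  apply: ler_sum => i _; rewrite -(ipnorm_sqr bP).
  by rewrite ler_pXn2r// ?nnegrE ?ipnorm_ge0.
rewrite sumr_const -[leLHS]mulr_natl exprMn ler_wpM2r ?sqr_ge0//.
by rewrite -natrX ler_nat; case: #|I| => [//|k]; rewrite expnS expn1 leq_pmulr.
Qed.

Lemma sum_ip_complete : ip_complete b -> ip_complete sum_ip.
Proof.
move=> cb u_ cau.
have /choice[w wP] : forall i, exists w, forall e : R, 0 < e -> exists k0,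
    forall k, (k0 <= k)%N -> ipnorm b (u_ k i - w) <= e.
  move=> i; apply: (cb (fun k => u_ k i)) => e /cau[k0 k0P].
  by exists k0 => k l /k0P H /H; exact: le_trans (ipnorm_le_sum (u_ k - u_ l) i).
exists w => e e0; have d0 : 0 < e / (#|I|%:R + 1) by rewrite divr_gt0// ltr_wpDl.
have /choice[K KP] : forall i, exists k0, forall k, (k0 <= k)%N ->
    ipnorm b (u_ k i - w i) <= e / (#|I|%:R + 1) by move=> i; exact: wP.
exists (\max_i K i)%N => k Kk.
apply: (@le_trans _ _ (#|I|%:R * (e / (#|I|%:R + 1)))).
  apply: ipnorm_sum_le (ltW d0) => i; apply: KP; apply: leq_trans Kk.
  exact: leq_bigmax.
rewrite mulrCA ler_piMr ?(ltW e0)// ler_pdivrMr ?ltr_wpDl// mul1r lerDl//.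
Qed.

End sum_semi_inner.

(** * From functions on [Omega] to elements of L^2 *)

Section l2_classes.
Context {R : realType} {n : nat}.
Local Notation m := n.+1.
Variable Omega : set 'rV[R]_m.
Hypotheses (oO : open Omega) (bO : bounded_set Omega).
Implicit Types f g v : 'rV[R]_m -> R.

Local Notation mu := (lebesgue_rV R m).
Local Notation in_L2 := (in_Lp Omega 2%:E).

Let mO : measurable Omega. Proof. exact: open_measurable_rV. Qed.

Local Notation L2 := (LfunType mu (@le1_2 R)).
Local Notation ip := (l2ip Omega).
Local Notation nrm := (ipnorm ip).

(** The default is 0 when [f] is not square integrable on [Omega]; this is why the rules below ask
    for membership in L^2. *)
Definition l2_class f : L2 := insubd (0 : L2) (f \_ Omega).
Local Notation mk := l2_class.

Lemma l2_classE f : in_L2 f -> mk f = f \_ Omega :> (_ -> _).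
Proof. by move=> f2; rewrite /l2_class /insubd insubT. Qed.

Lemma l2_class_in f x : in_L2 f -> Omega x -> mk f x = f x.
Proof. by move=> f2 Ox; rewrite l2_classE// patchE mem_set. Qed.

Lemma in_L2P f : measurable_fun setT (f \_ Omega) ->
  (\int[mu]_(x in Omega) (f x ^+ 2)%:E < +oo)%E -> in_L2 f.
Proof.
move=> mf fi; apply: Lfun2P => //; apply: le_lt_trans fi.
rewrite [leRHS]integral_mkcond le_eqVlt; apply/orP; left; apply/eqP.
apply: eq_integral => x _; rewrite !patchE; case: ifPn => //.
by rewrite expr0n.
Qed.

Lemma in_L2_measurable p f : in_Lp Omega p f -> measurable_fun setT (f \_ Omega).
Proof. by move=> /andP[]; rewrite inE. Qed.

Lemma in_L2_int f : in_L2 f -> (\int[mu]_(x in Omega) (f x ^+ 2)%:E < +oo)%E.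
Proof.
move=> f2; have := l2ip_sqrE mO (mk f).
rewrite (_ : \int[mu]_(x in Omega) _ = \int[mu]_(x in Omega) (f x ^+ 2)%:E)%E.
  by move=> <-; rewrite ltry.
by apply: eq_integral => x /[!inE] Ox; rewrite l2_class_in.
Qed.

Lemma in_L2_coe (v : L2) : in_L2 v.
Proof.
apply: in_L2P.
  apply/(measurable_restrictT _ mO); exact: measurable_funS (measurable_fun_Lfun v).
by rewrite -l2ip_sqrE// ltry.
Qed.

Lemma l2ip_class f g : in_L2 f -> in_L2 g -> ip (mk f) (mk g) = inner Omega f g.
Proof.
by move=> f2 g2; apply: eq_Rintegral => x /[!inE] Ox; rewrite !l2_class_in.
Qed.

Lemma l2ip_ae_eq (v v' w : L2) : ae_in Omega (fun x => v x = v' x) -> ip v w = ip v' w.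
Proof.
move=> vv'; rewrite /l2ip /Rintegral; congr fine.
apply: ae_eq_integral => //.
- exact: measurable_int (l2_integrable mO v w).
- exact: measurable_int (l2_integrable mO v' w).
- by move: vv'; rewrite /ae_in; apply: filterS => x vx Ox; rewrite /= vx.
Qed.

Lemma l2ip_eq_in (v v' w : L2) : (forall x, Omega x -> v x = v' x) -> ip v w = ip v' w.
Proof. by move=> vv'; apply: l2ip_ae_eq; apply: nearW. Qed.

Lemma L2normE f : in_L2 f -> L2norm Omega f = nrm (mk f).
Proof.
move=> f2; rewrite /L2norm unlock /ipnorm.
have -> : (\int[mu]_x (`|(EFin \o (f \_ Omega)) x| `^ 2) = (ip (mk f) (mk f))%:E)%E.
  rewrite l2ip_sqrE// [RHS]integral_mkcond; apply: eq_integral => x _.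
  rewrite /= [RHS]patchE powR_mulrn// real_normK ?num_real//.
  by case: ifPn => xO; rewrite patchE ?xO ?(negPf xO) ?l2_classE// ?patchE ?xO ?expr0n.
by rewrite poweR_EFin /= powR12_sqrt// (ip_ge0 (l2ip_semi_inner mu mO)).
Qed.

Lemma l2_class_lin (a : R) f g : in_L2 f -> in_L2 g ->
  in_L2 (fun x => a * f x + g x) /\ mk (fun x => a * f x + g x) = a *: mk f + mk g.
Proof.
move=> f2 g2.
have E : (fun x => a * f x + g x) \_ Omega = (a *: mk f + mk g : L2) :> ('rV[R]_m -> R).
  apply/funext => x; rewrite -[RHS]/(a * mk f x + mk g x) !l2_classE// !patchE.
  by case: ifPn => // _; rewrite mulr0 addr0.
have fg2 : in_L2 (fun x => a * f x + g x) by rewrite /in_Lp E; exact: LfunP.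
by split => //; apply/LfuneqP => x; rewrite l2_classE// E.
Qed.

Lemma in_L2_le (K : R) f g : measurable_fun setT (f \_ Omega) -> in_L2 g ->
  (forall x, Omega x -> `|f x| <= K * `|g x|) -> in_L2 f.
Proof.
move=> mf g2 fg; apply: in_L2P => //.
(* The combination [(K - 1) * g x + g x] is [K * g x]. *)
have [Kg2 _] := l2_class_lin (K - 1) g2 g2.
apply: le_lt_trans (in_L2_int Kg2).
apply: ge0_le_integral => //.
- by move=> x _; rewrite lee_fin sqr_ge0.
- apply/measurable_EFinP; apply: measurable_funX.
  exact/(measurable_restrictT _ mO).
- apply/measurable_EFinP; apply: measurable_funX.
  by apply/(measurable_restrictT _ mO); exact: in_L2_measurable Kg2.
move=> x Ox; rewrite lee_fin -[leLHS]real_normK ?num_real//.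
rewrite -[leRHS]real_normK ?num_real// ler_pXn2r// ?nnegrE//.
rewrite (_ : _ + _ = K * g x); last by ring.
by apply: le_trans (fg _ Ox) _; rewrite normrM ler_wpM2r// ler_norm.
Qed.

Lemma in_L2_bounded (B : R) f : measurable_fun setT (f \_ Omega) ->
  (forall x, Omega x -> `|f x| <= B) -> in_L2 f.
Proof.
move=> mf fB; apply: in_L2P => //.
apply: (@le_lt_trans _ _ (\int[mu]_(x in Omega) (B ^+ 2)%:E)%E).
  apply: ge0_le_integral => //.
  - by move=> x _; rewrite lee_fin sqr_ge0.
  - apply/measurable_EFinP; apply: measurable_funX.
    exact/(measurable_restrictT _ mO).
  move=> x Ox; rewrite lee_fin -[leLHS]real_normK ?num_real//.
  rewrite ler_pXn2r// ?nnegrE// ?fB//; exact: le_trans (fB _ Ox).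
rewrite integral_cst// lte_mul_pinfty ?lee_fin ?sqr_ge0//.
exact: bounded_measure_lty.
Qed.

Lemma l2norm_le (K : R) (v w : L2) : (forall x, Omega x -> `|v x| <= K * `|w x|) ->
  0 <= K -> nrm v <= K * nrm w.
Proof.
move=> vw K0; have ipP := l2ip_semi_inner mu mO.
rewrite -[K]ger0_norm// -(ipnormZ ipP) /ipnorm ler_wsqrtr//.
rewrite -lee_fin !l2ip_sqrE//; apply: ge0_le_integral => //.
- by move=> x _; rewrite lee_fin sqr_ge0.
- apply/measurable_EFinP; apply: measurable_funX.
  exact: measurable_funS (measurable_fun_Lfun v).
- apply/measurable_EFinP; apply: measurable_funX.
  exact: measurable_funS (measurable_fun_Lfun (K *: w)).
move=> x Ox; rewrite lee_fin -[leLHS]real_normK ?num_real//.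
rewrite -[leRHS]real_normK ?num_real// ler_pXn2r// ?nnegrE//.
by rewrite -[(K *: w) x]/(K * w x) normrM (ger0_norm K0); exact: vw.
Qed.

Lemma test_function_in_L2 phi : test_function Omega phi -> in_L2 phi.
Proof.
move=> tphi; have [B phiB] := test_function_bounded tphi.
apply: (in_L2_bounded (B := B)) => //.
apply/(measurable_restrictT _ mO).
exact: measurable_funS (test_function_measurable tphi).
Qed.

Definition test_pair (x : L2) (y : 'I_m -> L2) := exists phi,
  [/\ test_function Omega phi, x = mk phi & y = fun i => mk (partial i phi)].

Local Notation ipY := (sum_ip ip).

Lemma test_pair_lin (a : R) x y x' y' : test_pair x y -> test_pair x' y' ->
  test_pair (a *: x + x') (a *: y + y').
Proof.
move=> [phi [tphi -> ->]] [psi [tpsi -> ->]].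
exists (fun z => a * phi z + psi z); split; first exact: test_function_lin.
  by rewrite (l2_class_lin _ (test_function_in_L2 tphi) (test_function_in_L2 tpsi)).2.
apply/funext => i; rewrite partial_lin; [|exact: tphi.1|exact: tpsi.1].
have tphi' := test_function_in_L2 (test_function_partial i tphi).
have tpsi' := test_function_in_L2 (test_function_partial i tpsi).
by rewrite (l2_class_lin _ tphi' tpsi').2.
Qed.

Lemma test_pair0 : test_pair 0 0.
Proof.
have t0 := test_function0 Omega.
have [phi [tphi E E']] : test_pair (mk (fun=> 0)) (fun i => mk (partial i (fun=> 0))).
  by exists (fun=> 0).
have := test_pair_lin (-1) (ex_intro _ _ (And3 tphi E E')) (ex_intro _ _ (And3 tphi E E')).
by rewrite !scaleN1r !addNr.
Qed.

Lemma test_pair_poincare : exists2 C : R, 0 < C &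
  forall x y, test_pair x y -> nrm x <= C * ipnorm ipY y.
Proof.
have [C C0 CP] := poincare_rV bO; exists C => // _ _ [phi [tphi -> ->]].
have ipP := l2ip_semi_inner mu mO.
pose y : 'I_m -> L2 := fun i => mk (partial i phi).
apply: (@le_trans _ _ (C * nrm (y ord0))); last first.
  by rewrite ler_pM2l//; exact: (ipnorm_le_sum ipP y ord0).
have key f : test_function Omega f ->
    (ip (mk f) (mk f))%:E = (\int[mu]_x (f x ^+ 2)%:E)%E.
  move=> tf; rewrite l2ip_sqrE// integral_mkcond; apply: eq_integral => x _.
  rewrite patchE; case: ifPn => xO.
    by rewrite l2_class_in//; [exact: test_function_in_L2|exact: set_mem].
  by rewrite (test_function_out tf) ?expr0n// => /mem_set; exact/negP.
rewrite -(@ler_pXn2r _ 2)// ?nnegrE ?mulr_ge0 ?ipnorm_ge0 ?(ltW C0)//.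
rewrite exprMn !(ipnorm_sqr ipP) -lee_fin EFinM !key//; first exact: CP.
exact: test_function_partial.
Qed.

End l2_classes.

(** * Weak solutions and abstract Poisson equations *)

Section weak_solutions.
Context {R : realType} {n : nat}.
Local Notation m := n.+1.
Variable Omega : set 'rV[R]_m.
Hypotheses (oO : open Omega) (bO : bounded_set Omega).
Implicit Types f g v : 'rV[R]_m -> R.

Local Notation mu := (lebesgue_rV R m).
Local Notation in_L2 := (in_Lp Omega 2%:E).

Let mO : measurable Omega. Proof. exact: open_measurable_rV. Qed.

Local Notation L2 := (LfunType mu (@le1_2 R)).
Local Notation ip := (@l2ip R _ _ mu Omega).
Local Notation nrm := (ipnorm ip).
Local Notation ipY := (sum_ip ip).
Local Notation mk := (l2_class Omega).
Local Notation poisson := (weak_poisson ip ipY (@test_pair R n Omega)).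

Let ipP : semi_inner ip := l2ip_semi_inner mu mO.

Lemma in_L2B f g : in_L2 f -> in_L2 g -> in_L2 (f \- g).
Proof.
move=> f2 g2; have := (l2_class_lin (-1) g2 f2).1.
by rewrite (_ : (fun _ => _) = f \- g)//; apply/funext => x /=; ring.
Qed.

Lemma l2_classB f g : in_L2 f -> in_L2 g -> mk (f \- g) = mk f - mk g.
Proof.
move=> f2 g2; have [_] := l2_class_lin (-1) g2 f2.
rewrite (_ : (fun _ => _) = f \- g); last by apply/funext => x /=; ring.
by move=> ->; rewrite scaleN1r addrC.
Qed.

Lemma L2normBE f g : in_L2 f -> in_L2 g -> L2norm Omega (f \- g) = nrm (mk f - mk g).
Proof. by move=> f2 g2; rewrite (L2normE oO)// ?l2_classB//; exact: in_L2B. Qed.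

(** [mk v] is [v] cut off outside [Omega]: the two may differ as functions, but the seminorm does
    not see it. *)
Lemma ipnorm_class_coe (v : L2) : nrm (mk v - v) = 0.
Proof.
have v2 := in_L2_coe oO v.
have : ip (mk v - v) (mk v - v) = ip 0 (mk v - v).
  apply: (l2ip_eq_in oO) => x Ox; rewrite -[LHS]/(mk v x - v x).
  by rewrite l2_class_in// subrr.
by rewrite ip0l// /ipnorm => ->; rewrite sqrtr0.
Qed.

Lemma l2ip_class_coe (v w : L2) : ip (mk v) w = ip v w.
Proof.
apply/eqP; rewrite -subr_eq0 -ipBl//; apply/eqP.
by apply: ipnorm_eq0 => //; exact: ipnorm_class_coe.
Qed.

(** The nonlinear term, evaluated at [v], is moved to the right-hand side, so one abstract notion
    serves for the state, the linearized and the smoothed equation. *)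
Lemma weak_solution_poisson F f v : in_L2 f -> weak_solution Omega F f v ->
  in_L2 (F v) -> in_L2 v /\ exists w, poisson (mk f - mk (F v)) (mk v) w.
Proof.
move=> f2 [w [v2 w2 [phi [tphi phiv phiw]]] eqw] Fv2; split => //.
exists (fun i => mk (w i)); split => [e e0|x y [psi [tpsi -> ->]]]; last first.
  have psi2 := test_function_in_L2 oO bO tpsi.
  rewrite (ipBl ipP) !l2ip_class// -eqw// addrK /sum_ip.
  apply: eq_bigr => i _; rewrite l2ip_class//.
  by apply/(test_function_in_L2 oO bO)/test_function_partial.
pose d := e / (#|'I_m|%:R + 1).
have d0 : 0 < d by rewrite divr_gt0// ltr_wpDl.
have /cvgrPdist_le/(_ _ e0) H1 := phiv.
have H2 : \forall k \near \oo, forall i,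
    `|0 - L2norm Omega (partial i (phi k) \- w i)| <= d.
  by apply: filter_forall => i; have /cvgrPdist_le/(_ _ d0) := phiw i.
have [k [kv kw]] : exists k, `|0 - L2norm Omega (phi k \- v)| <= e /\
    forall i, `|0 - L2norm Omega (partial i (phi k) \- w i)| <= d.
  have [K _ KP] := filterI H1 H2.
  by exists K; have [? ?] := KP K (leqnn K).
have phi2 := test_function_in_L2 oO bO (tphi k).
exists (mk (phi k)), (fun i => mk (partial i (phi k))); split.
- by exists (phi k).
- by move: kv; rewrite sub0r normrN L2normBE// => /ler_normlW.
apply: le_trans (ipnorm_sum_le ipP (e := d) _ (ltW d0)) _.
  move=> i; have := kw i; rewrite sub0r normrN L2normBE//.
    by move=> /ler_normlW.
  by apply/(test_function_in_L2 oO bO)/test_function_partial.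
rewrite /d mulrCA ler_piMr ?(ltW e0)// ler_pdivrMr ?ltr_wpDl// mul1r lerDl//.
Qed.

Lemma poisson_weak_solution (F : ('rV[R]_m -> R) -> 'rV[R]_m -> R) f (v : L2) w :
  in_L2 f -> in_L2 (F v) -> poisson (mk f - mk (F v)) v w -> weak_solution Omega F f v.
Proof.
move=> f2 Fv2 [cl eqw]; have v2 := in_L2_coe oO v.
exists (fun i => w i : 'rV[R]_m -> R); last first.
  move=> phi tphi; have phi2 := test_function_in_L2 oO bO tphi.
  have tp : test_pair Omega (mk phi) (fun i => mk (partial i phi)) by exists phi.
  have := eqw _ _ tp; rewrite (ipBl ipP) !l2ip_class// => E.
  transitivity (sum_ip ip w (fun i => mk (partial i phi)) + inner Omega (F v) phi).
    congr (_ + _); apply: eq_bigr => i _.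
    rewrite -l2ip_class_coe l2ip_class//; first exact: in_L2_coe.
    by apply/(test_function_in_L2 oO bO)/test_function_partial.
  by rewrite E subrK.
split => // [i|]; first exact: in_L2_coe.
(* The [e]-wise closure becomes a sequence by taking [e = k.+1%:R^-1]. *)
have /choice[phi phiP] : forall k : nat, exists phi, [/\ test_function Omega phi,
    nrm (mk phi - v) <= k.+1%:R^-1 &
    forall i, nrm (mk (partial i phi) - w i) <= k.+1%:R^-1].
  move=> k; have [|x [y [[phi [tphi -> ->]] hx hy]]] := cl k.+1%:R^-1.
    by rewrite invr_gt0.
  exists phi; split => // i; apply: le_trans hy.
  exact: (ipnorm_le_sum ipP ((fun i => mk (partial i phi)) - w)).
have coeB g (z : L2) : in_L2 g -> L2norm Omega (g \- z) = nrm (mk g - z).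
  move=> g2; rewrite L2normBE//; last exact: in_L2_coe.
  apply/eqP; rewrite eq_le; apply/andP; split.
    apply: le_trans (ipnorm_split ipP _ z _) _.
    by rewrite (ipnorm_distC ipP z) ipnorm_class_coe addr0.
  apply: le_trans (ipnorm_split ipP _ (mk z) _) _.
  by rewrite ipnorm_class_coe addr0.
have small (a : nat -> R) : (forall k, 0 <= a k <= k.+1%:R^-1) -> a k @[k --> \oo] --> 0.
  move=> aP; apply: (@squeeze_cvgr _ _ _ _ (cst 0) (fun k => k.+1%:R^-1)).
  - by apply: nearW => k; exact: aP.
  - exact: cvg_cst.
  - exact: cvg_harmonic.
exists phi; split => [k|//|i].
- by have [] := phiP k.
- apply: small => k; have [tphi h _] := phiP k.
  by rewrite coeB ?h ?ipnorm_ge0//; exact: (test_function_in_L2 oO bO).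
- apply: small => k; have [tphi _ h] := phiP k.
  rewrite coeB ?h ?ipnorm_ge0//.
  by apply/(test_function_in_L2 oO bO)/test_function_partial.
Qed.

End weak_solutions.

(** * Superposition operators *)

Section superposition.
Context {R : realType} {n : nat}.
Local Notation m := n.+1.
Variable Omega : set 'rV[R]_m.
Hypotheses (oO : open Omega) (bO : bounded_set Omega).

Local Notation mu := (lebesgue_rV R m).
Local Notation in_L2 := (in_Lp Omega 2%:E).

Let mO : measurable Omega. Proof. exact: open_measurable_rV. Qed.

Local Notation L2 := (LfunType mu (@le1_2 R)).
Local Notation ip := (@l2ip R _ _ mu Omega).
Local Notation nrm := (ipnorm ip).
Local Notation ipY := (sum_ip ip).
Local Notation mk := (l2_class Omega).
Local Notation poisson := (weak_poisson ip ipY (@test_pair R n Omega)).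

Let ipP : semi_inner ip := l2ip_semi_inner mu mO.
Let ipYP : semi_inner (ipY : ('I_m -> L2) -> _) := sum_ip_semi_inner _ ipP.
Let cX : ip_complete ip := @l2ip_complete _ _ _ mu _ mO.
Let cY : ip_complete (ipY : ('I_m -> L2) -> _) := @sum_ip_complete _ _ _ _ ipP cX.

Definition superpose (f : 'rV[R]_m -> R -> R) (v : 'rV[R]_m -> R) :=
  fun x => f x (v x).

(** Both the network and its linearization at a state are instances, with the same [K]. The
    Lipschitz bound and boundedness at 0 give a map from L^2 to L^2; monotonicity gives solvability
    and stability. *)
Record nemytskii (f : 'rV[R]_m -> R -> R) (K : R) : Prop := Nemytskii {
  nemytskii_meas : forall v, measurable_fun setT (v \_ Omega) ->
    measurable_fun setT (superpose f v \_ Omega);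
  nemytskii_lip : forall x a b, `|f x a - f x b| <= K * `|a - b|;
  nemytskii_bd : exists B, forall x, Omega x -> `|f x 0| <= B;
  nemytskii_homo : forall x, {homo f x : a b / a <= b} }.

Variables (f : 'rV[R]_m -> R -> R) (K : R).
Hypotheses (K0 : 0 < K) (nf : nemytskii f K).

Lemma nemytskii_in_L2 v : in_L2 v -> in_L2 (superpose f v).
Proof.
move=> v2; have [B fB] := nemytskii_bd nf.
have m0 : measurable_fun setT (superpose f (fun=> 0) \_ Omega).
  by apply: (nemytskii_meas nf); apply/(measurable_restrictT _ mO).
have f02 : in_L2 (superpose f (fun=> 0)) by apply: (in_L2_bounded oO bO (B := B)).
have d2 : in_L2 (fun x => superpose f v x - superpose f (fun=> 0) x).
  apply: (in_L2_le oO (K := K) (g := v)) => //; last first.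
    by move=> x _; have := nemytskii_lip nf x (v x) 0; rewrite subr0.
  apply/(measurable_restrictT _ mO); apply: measurable_funB;
    apply/(measurable_restrictT _ mO) => //.
  by apply: (nemytskii_meas nf); exact: in_L2_measurable v2.
have := (l2_class_lin 1 d2 f02).1.
by rewrite (_ : (fun _ => _) = superpose f v)//; apply/funext => x; ring.
Qed.

Definition superposeL2 (v : L2) : L2 := mk (superpose f v).

Lemma superposeL2_class v : in_L2 v -> superposeL2 (mk v) = mk (superpose f v).
Proof.
move=> v2; rewrite /superposeL2 /l2_class; congr insubd; apply/funext => x.
rewrite !patchE; case: ifPn => // xO; rewrite /superpose l2_class_in//; exact: set_mem.
Qed.

Lemma superposeL2E (v : L2) x : Omega x -> superposeL2 v x = f x (v x).
Proof. by move=> Ox; rewrite /superposeL2 l2_class_in//; apply/nemytskii_in_L2/in_L2_coe. Qed.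

Lemma superposeL2_monotone : ip_monotone ip superposeL2.
Proof.
move=> u v; apply: Rintegral_ge0 => x Ox.
rewrite -[X in X * _]/(superposeL2 u x - superposeL2 v x) -[X in _ * X]/(u x - v x) !superposeL2E//.
have [uv|/ltW uv] := leP (u x) (v x).
  by rewrite mulr_le0// subr_le0// (nemytskii_homo nf).
by rewrite mulr_ge0// subr_ge0// (nemytskii_homo nf).
Qed.

(** For [a <= b] monotonicity and the Lipschitz bound give [0 <= f x b - f x a <= K * (b - a)], so
    [K * s - f x s] changes by at most [K * (b - a)]. A Lipschitz bound alone would only give
    [2 * K]. *)
Lemma superposeL2_nonexpansive u v :
  nrm ((K *: u - superposeL2 u) - (K *: v - superposeL2 v)) <= K * nrm (u - v).
Proof.
apply: (l2norm_le oO); last exact: ltW.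
move=> x Ox.
rewrite -[X in `|X|]/((K * u x - superposeL2 u x) - (K * v x - superposeL2 v x)).
rewrite -[X in _ * `|X|]/(u x - v x) !superposeL2E//.
move: (nemytskii_lip nf x (u x) (v x)).
wlog uv : u v / u x <= v x.
  move=> H; have [uv|/ltW uv] := leP (u x) (v x); first exact: H.
  by rewrite distrC [X in _ <= _ * X -> _]distrC [X in _ -> X <= _]distrC
    [X in _ -> _ <= _ * X]distrC; exact: H.
have fuv := nemytskii_homo nf x uv.
rewrite [`|f _ _ - _|]ler0_norm ?subr_le0// [`|u x - _|]ler0_norm ?subr_le0//.
by move=> h; rewrite ler_norml; apply/andP; split; nra.
Qed.

Lemma superposeL2_poisson_exists (g : L2) : exists v w, poisson (g - superposeL2 v) v w.
Proof.
have [C C0 CP] := test_pair_poincare oO bO.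
exact: (monotone_poisson_exists ipP ipYP cX cY (test_pair0 oO bO)
  (test_pair_lin oO bO) C0 CP g K0 superposeL2_nonexpansive).
Qed.

Lemma superpose_weak_solution_exists h : in_L2 h ->
  exists v : L2, weak_solution Omega (superpose f) h v.
Proof.
move=> h2; have [v [w vw]] := superposeL2_poisson_exists (mk h); exists v.
by apply: (poisson_weak_solution oO bO _ _ vw) => //;
  apply/nemytskii_in_L2/in_L2_coe.
Qed.

End superposition.

(** * Networks and their linearizations as superposition operators *)

Section net_nemytskii.
Context {R : realType} {n : nat}.
Local Notation m := n.+1.
Variable Omega : set 'rV[R]_m.
Hypotheses (oO : open Omega) (bO : bounded_set Omega).
Variable N : relu_net R m 1.
Hypothesis N_homo : forall x, {homo (fun y => net_eval N x y 0 0) : y1 y2 / y1 <= y2}.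

Local Notation mu := (lebesgue_rV R m).
Local Notation in_L2 := (in_Lp Omega 2%:E).

Let mO : measurable Omega. Proof. exact: open_measurable_rV. Qed.

Local Notation L2 := (LfunType mu (@le1_2 R)).
Local Notation ip := (@l2ip R _ _ mu Omega).
Local Notation nrm := (ipnorm ip).
Local Notation mk := (l2_class Omega).
Let ipP : semi_inner ip := l2ip_semi_inner mu mO.

Definition net_fun (x : 'rV[R]_m) (y : R) : R := net_eval N x y 0 0.
Definition net_dfun (sig : R -> R) (y : 'rV[R]_m -> R) (x : 'rV[R]_m) (s : R) : R :=
  net_deriv sig N x (y x) s 0 0.

Lemma measurable_relu : measurable_fun setT (@relu R).
Proof. by apply: measurable_maxr. Qed.

Lemma net_deriv_quot x y s : exists2 t0 : R, 0 < t0 & forall t, 0 < t -> t <= t0 ->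
  t^-1 * (net_fun x (y + t * s) - net_fun x y) = net_deriv relu N x y s 0 0.
Proof.
have [t0 t0_gt0 H] := net_eval_deriv N x y s; exists t0 => // t t_gt0 tt0.
by rewrite /net_fun (H t (ltW t_gt0) tt0) addrC addKr mulrA mulVf ?mul1r ?gt_eqF.
Qed.

(** A common step [t] for two directions lets the derivative inherit from the network every property
    stable under difference quotients, here monotonicity and the Lipschitz constant. *)
Lemma net_deriv_quot2 x y s s' : exists2 t : R, 0 < t &
  t^-1 * (net_fun x (y + t * s) - net_fun x y) = net_deriv relu N x y s 0 0 /\
  t^-1 * (net_fun x (y + t * s') - net_fun x y) = net_deriv relu N x y s' 0 0.
Proof.
have [t0 t0_gt0 H] := net_deriv_quot x y s.
have [t1 t1_gt0 H'] := net_deriv_quot x y s'.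
exists (Num.min t0 t1); first by rewrite lt_min t0_gt0.
have t_gt0 : 0 < Num.min t0 t1 by rewrite lt_min t0_gt0.
by split; [apply: H|apply: H'] => //; rewrite ge_min lexx ?orbT.
Qed.

Lemma net_dfun_scale (y : 'rV[R]_m -> R) x (c s : R) : 0 < c ->
  net_dfun relu y x (c * s) = c * net_dfun relu y x s.
Proof.
move=> c0; have [t0 t0_gt0 H] := net_deriv_quot x (y x) (c * s).
have [t1 t1_gt0 H'] := net_deriv_quot x (y x) s.
(* A step [t] in direction [c * s] is a step [t * c] in direction [s]; the minimum makes both
   admissible. *)
pose t := Num.min t0 (t1 / c).
have t_gt0 : 0 < t by rewrite lt_min t0_gt0 divr_gt0.
have E := H t t_gt0; have E' := H' (t * c) (mulr_gt0 t_gt0 c0).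
rewrite /net_dfun -E ?ge_min ?lexx// -E'; last first.
  by rewrite -ler_pdivlMr// ge_min lexx orbT.
rewrite (mulrA t c s); move: (net_fun _ _ - _) => D.
by rewrite invfM mulrA mulrCA divff ?gt_eqF// mulr1.
Qed.

Lemma net_dfun0 (y : 'rV[R]_m -> R) x : net_dfun relu y x 0 = 0.
Proof.
have [t t0 /(_ t t0 (lexx _))] := net_deriv_quot x (y x) 0.
by rewrite mulr0 addr0 subrr mulr0 /net_dfun.
Qed.

Lemma net_nemytskii : exists2 K : R, 0 < K & nemytskii Omega net_fun K /\
  forall y, measurable_fun setT (y \_ Omega) -> nemytskii Omega (net_dfun relu y) K.
Proof.
have [L L0 LP] := net_eval_lipschitz N.
have [M M0 OM] := bounded_set_box bO; have [B B0 BP] := net_eval_bounded N M.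
have lip x a b : `|net_fun x a - net_fun x b| <= (L + 1) * `|a - b|.
  by apply: le_trans (LP x a b 0) _; rewrite ler_wpM2r// lerDl.
(* The existence result needs a positive constant, and [L] may be 0. *)
exists (L + 1); first by rewrite ltr_wpDl.
split=> [|y my].
  split=> //.
  - move=> v mv; rewrite (_ : _ \_ _ = superpose net_fun (v \_ Omega) \_ Omega).
      by apply/(measurable_restrictT _ mO); apply: measurable_funS
        (measurable_net_eval N 0 mv).
    apply/funext => x; rewrite !patchE /superpose; case: ifPn => // xO.
    by rewrite patchE xO.
  - by exists B => x /OM Mx; exact: BP.
split.
- move=> v mv.
  rewrite (_ : _ \_ _ = superpose (net_dfun relu (y \_ Omega)) (v \_ Omega) \_ Omega).
    apply/(measurable_restrictT _ mO); apply: measurable_funS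
      (measurable_net_deriv N 0 measurable_relu my mv) => //.
  apply/funext => x; rewrite !patchE /superpose /net_dfun; case: ifPn => // xO.
  by rewrite !patchE xO.
- move=> x a b; rewrite /net_dfun; have [t t0 [<- <-]] := net_deriv_quot2 x (y x) a b.
  rewrite -mulrBr opprB addrA subrK normrM normfV (gtr0_norm t0).
  rewrite ler_pdivrMl//; apply: le_trans (lip _ _ _) _.
  by rewrite opprD addrACA subrr add0r -mulrBr normrM (gtr0_norm t0) mulrCA.
- by exists 0 => x _; rewrite net_dfun0 normr0.
- move=> x a b ab; rewrite /net_dfun; have [t t0 [<- <-]] := net_deriv_quot2 x (y x) a b.
  rewrite ler_pM2l ?invr_gt0// lerB// N_homo// lerD2l ler_pM2l//.
Qed.

(** Dominated convergence along an arbitrary sequence of positive steps: at each point the quotient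
    eventually equals the derivative, and quotient and derivative are both bounded by [K * |z x|],
    so [(2 * K * z x) ^+ 2] dominates the squared difference. *)
Lemma net_directional (y z : 'rV[R]_m -> R) : in_L2 y -> in_L2 z ->
  nrm (t^-1 *: (superposeL2 Omega net_fun (mk y + t *: mk z) - superposeL2 Omega net_fun (mk y)) -
    mk (superpose (net_dfun relu y) z)) @[t --> 0^'+] --> 0.
Proof.
move=> y2 z2; have [K K0 [nN /(_ y (in_L2_measurable y2)) nD]] := net_nemytskii.
apply/cvg_at_rightP => t [t_gt0 t_cvg].
pose q k : L2 := (t k)^-1 *: (superposeL2 Omega net_fun (mk y + t k *: mk z) -
    superposeL2 Omega net_fun (mk y)) - mk (superpose (net_dfun relu y) z).
have qE k x : Omega x -> q k x = (t k)^-1 * (net_fun x (y x + t k * z x) -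
    net_fun x (y x)) - net_dfun relu y x (z x).
  move=> Ox; rewrite -[LHS]/((t k)^-1 * (superposeL2 Omega net_fun (mk y + t k *: mk z) x -
    superposeL2 Omega net_fun (mk y) x) - mk (superpose (net_dfun relu y) z) x).
  rewrite !(superposeL2E oO bO nN)// -[(mk y + t k *: mk z) x]/(mk y x + t k * mk z x).
  by rewrite !l2_class_in//; exact: (nemytskii_in_L2 oO bO nD).
have q0 : (\int[mu]_(x in Omega) (q k x ^+ 2)%:E)%E @[k --> \oo] --> (0%:E)%E.
  have gE : mu.-integrable Omega (EFin \o (fun x => (2 * K) ^+ 2 * (mk z x * mk z x))).
    exact: (integrableZl mO ((2 * K) ^+ 2) (l2_integrable mO (mk z) (mk z))).
  have [||||_ _] := @dominated_convergence _ _ _ mu Omega mO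
    (fun k x => (q k x ^+ 2)%:E) (cst 0%E) _ _ _ _ gE; last by rewrite integral0.
  - move=> k; apply/measurable_EFinP; apply: measurable_funX.
    exact: measurable_funS (measurable_fun_Lfun (q k)).
  - exact: measurable_cst.
  - apply: nearW => x Ox; have [t0 t0_gt0 H] := net_deriv_quot x (y x) (z x).
    apply: cvg_near_cst.
    have : \forall k \near \oo, t k < t0 by apply: (cvgr_lt _ t_cvg).
    apply: filterS => k /ltW tk.
    by rewrite qE// H// subrr expr0n.
  - apply: nearW => x k Ox; rewrite gee0_abs ?lee_fin ?sqr_ge0//.
    rewrite qE// !l2_class_in// -expr2 -exprMn -[leLHS]real_normK ?num_real//.
    rewrite -[leRHS]real_normK ?num_real// ler_pXn2r// ?nnegrE//.
    apply: le_trans (ler_normB _ _) _.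
    rewrite [leRHS]normrM (ger0_norm (mulr_ge0 _ (ltW K0)))// -mulrA mulr_natl mulr2n.
    apply: lerD.
      rewrite normrM normfV (gtr0_norm (t_gt0 k)) ler_pdivrMl//.
      apply: le_trans (nemytskii_lip nN _ _ _) _.
      by rewrite addrC addKr normrM (gtr0_norm (t_gt0 k)) mulrCA.
    by have := nemytskii_lip nD x (z x) 0; rewrite subr0 net_dfun0 subr0.
have q0' : ip (q k) (q k) @[k --> \oo] --> (0 : R).
  have E : (fun k => ip (q k) (q k)) =
      (fun k => fine (\int[mu]_(x in Omega) (q k x ^+ 2)%:E)%E).
    by apply/funext => k; rewrite -l2ip_sqrE.
  by rewrite E; exact: (fine_cvg q0).
have := cvg_comp _ _ q0' (@sqrt_continuous R 0).
by rewrite sqrtr0.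
Qed.

End net_nemytskii.

(** * The directional derivative of the objective *)

(** [d] is the difference quotient of the states and [E] bounds its distance to the linearized state
    [z]. The cost being quadratic, the deviation is exactly [b G (d - z)] plus [t] times the
    quadratic cost of [d] and [H]. *)
Lemma tracking_quotient {R : realType} {X : lmodType R} (b : X -> X -> R)
    (bP : semi_inner b) (G U H d z : X) (alpha t E : R) :
  0 < t -> 0 < alpha -> ipnorm b (d - z) <= E ->
  `|t^-1 * ((2^-1 * ipnorm b (G + t *: d) ^+ 2 + alpha / 2 * ipnorm b (U + t *: H) ^+ 2) -
     (2^-1 * ipnorm b G ^+ 2 + alpha / 2 * ipnorm b U ^+ 2)) -
   (b G z + alpha * b U H)| <=
  ipnorm b G * E + t * (2^-1 * (ipnorm b z + E) ^+ 2 + alpha / 2 * ipnorm b H ^+ 2).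
Proof.
move=> t0 a0 dzE.
have -> : t^-1 * ((2^-1 * ipnorm b (G + t *: d) ^+ 2 + alpha / 2 * ipnorm b (U + t *: H) ^+ 2) -
     (2^-1 * ipnorm b G ^+ 2 + alpha / 2 * ipnorm b U ^+ 2)) - (b G z + alpha * b U H) =
   b G (d - z) + t * (2^-1 * ipnorm b d ^+ 2 + alpha / 2 * ipnorm b H ^+ 2).
  rewrite !ipnorm_sqr// !(ipDl bP) !(ipDr bP) !(ipZl bP) !(ipZr bP) (ipNr bP).
  rewrite (ipC bP d G) (ipC bP H U); field; exact: lt0r_neq0.
apply: le_trans (ler_normD _ _) _; apply: lerD.
  by apply: le_trans (ip_CS bP _ _) _; rewrite ler_wpM2l ?ipnorm_ge0.
have p1 : 0 <= 2^-1 * ipnorm b d ^+ 2 + alpha / 2 * ipnorm b H ^+ 2.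
  by apply: addr_ge0; apply: mulr_ge0; rewrite ?sqr_ge0 ?divr_ge0 ?(ltW a0). 
rewrite ger0_norm ?mulr_ge0 ?(ltW t0)// ler_pM2l// lerD2r ler_pM2l//.
have dz : ipnorm b d <= ipnorm b z + E.
  have := ipnormD bP z (d - z); rewrite addrC subrK => /le_trans; apply.
  by rewrite lerD2l.
by rewrite ler_pXn2r// nnegrE ?ipnorm_ge0// (le_trans (ipnorm_ge0 b d)).
Qed.

Section objective.
Context {R : realType} {n : nat}.
Local Notation m := n.+1.
Variable Omega : set 'rV[R]_m.
Hypotheses (oO : open Omega) (bO : bounded_set Omega).
Variable N : relu_net R m 1.
Hypothesis N_homo : forall x, {homo (fun y => net_eval N x y 0 0) : y1 y2 / y1 <= y2}.

Local Notation mu := (lebesgue_rV R m).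
Local Notation in_L2 := (in_Lp Omega 2%:E).

Let mO : measurable Omega. Proof. exact: open_measurable_rV. Qed.

Local Notation L2 := (LfunType mu (@le1_2 R)).
Local Notation ip := (@l2ip R _ _ mu Omega).
Local Notation nrm := (ipnorm ip).
Local Notation ipY := (sum_ip ip).
Local Notation mk := (l2_class Omega).
Local Notation poisson := (weak_poisson ip ipY (@test_pair R n Omega)).
Let ipP : semi_inner ip := l2ip_semi_inner mu mO.
Let ipYP : semi_inner (ipY : ('I_m -> L2) -> _) := sum_ip_semi_inner _ ipP.
Local Notation NN := (superposeL2 Omega (net_fun N)).
Local Notation state := (state Omega N).

(** Existence rules out the default value of [xget]. Which solution is picked is irrelevant for the
    estimates, by stability. *)
Lemma state_weak_solution u : in_L2 u ->
  weak_solution Omega (superpose_net N) u (state u).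
Proof.
move=> u2; have [K K0 [nN _]] := net_nemytskii oO bO N_homo.
have [v vP] := superpose_weak_solution_exists oO bO K0 nN u2.
by apply: (xgetPex (cst 0) (P := [set y | weak_solution Omega (superpose_net N) u y]));
  exists (v : 'rV[R]_m -> R).
Qed.

Lemma state_poisson u : in_L2 u -> in_L2 (state u) /\
  exists w, poisson (mk u - NN (mk (state u))) (mk (state u)) w.
Proof.
move=> u2; have [K K0 [nN _]] := net_nemytskii oO bO N_homo.
have sP := state_weak_solution u2.
have s2 : in_L2 (state u) by case: sP => w [].
have [_ H] := weak_solution_poisson oO bO u2 sP (nemytskii_in_L2 oO bO nN s2).
by split => //; rewrite superposeL2_class.
Qed.

(** [objective_deriv] is a [lim], so its value requires actual convergence. The quotients stay
    within [B t] of the claimed value, and [B t] tends to 0 because the linearization error [Q t]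
    does. *)
Lemma objective_deriv_cvg (g u h : 'rV[R]_m -> R) (alpha : R) z w :
  in_L2 g -> in_L2 u -> in_L2 h -> in_L2 z -> 0 < alpha ->
  poisson (mk h - mk (superpose (net_dfun N relu (state u)) z)) (mk z) w ->
  objective_deriv Omega N g alpha u h =
  ip (mk (state u) - mk g) (mk z) + alpha * ip (mk u) (mk h).
Proof.
move=> g2 u2 h2 z2 a0 zP; have [K K0 [nN nD]] := net_nemytskii oO bO N_homo.
have [C C0 CP] := test_pair_poincare oO bO.
have [y2 [wy yP]] := state_poisson u2.
pose Q t := t^-1 *: (NN (mk (state u) + t *: mk z) - NN (mk (state u))) -
    mk (superpose (net_dfun N relu (state u)) z).
have Qcvg : nrm (Q t) @[t --> 0^'+] --> 0.
  exact: (net_directional oO bO N_homo y2).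
pose G := mk (state u) - mk g.
pose E t := C ^+ 2 * nrm (Q t).
pose B t := nrm G * E t + t * (2^-1 * ((nrm (mk z) + E t) * (nrm (mk z) + E t)) +
  alpha / 2 * nrm (mk h) ^+ 2).
have Ecvg : E t @[t --> 0^'+] --> 0.
  by rewrite -[X in _ --> X](mulr0 (C ^+ 2)); apply: cvgM => //; exact: cvg_cst.
have zE : nrm (mk z) + E t @[t --> 0^'+] --> nrm (mk z) + 0.
  by apply: cvgD => //; exact: cvg_cst.
have Bcvg : B t @[t --> 0^'+] --> 0.
  have B0 : nrm G * 0 + 0 * (2^-1 * ((nrm (mk z) + 0) * (nrm (mk z) + 0)) +
      alpha / 2 * nrm (mk h) ^+ 2) = 0 :> R by rewrite mulr0 mul0r addr0.
  rewrite -[X in _ --> X]B0.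
  apply: cvgD; first by apply: cvgM => //; exact: cvg_cst.
  apply: cvgM; first exact: (cvg_at_right_filter cvg_id).
  apply: cvgD; last exact: cvg_cst.
  apply: cvgM; first exact: cvg_cst.
  exact: cvgM.
set l := RHS.
suff H : forall t, 0 < t ->
    `|t^-1 * (objective Omega N g alpha (u \+ t \*: h) - objective Omega N g alpha u) - l| <= B t.
  apply: cvg_lim => //.
  apply: (@squeeze_cvgr _ _ _ _ (fun t => l - B t) (fun t => l + B t)).
  - near=> t; have := H t; rewrite ler_distl; apply.
    by near: t; exact: nbhs_right_gt.
  - by rewrite -[X in _ --> X]subr0; apply: cvgB => //; exact: cvg_cst.
  - by rewrite -[X in _ --> X]addr0; apply: cvgD => //; exact: cvg_cst.
move=> t t0.
have [uh2 uhE] := l2_class_lin t h2 u2.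
have uhE' : (fun x => t * h x + u x) = u \+ t \*: h.
  by apply/funext => x /=; rewrite addrC.
rewrite uhE' in uh2 uhE.
have [yt2 [wt ytP]] := state_poisson uh2.
rewrite uhE in ytP.
pose d := t^-1 *: (mk (state (u \+ t \*: h)) - mk (state u)).
have dE : nrm (d - mk z) <= E t.
  exact: (poisson_deriv ipP ipYP (test_pair_lin oO bO) C0 CP t0
    (superposeL2_monotone oO bO nN) yP ytP zP).
have Gd : mk (state (u \+ t \*: h)) - mk g = G + t *: d.
  rewrite /d scalerA mulfV ?gt_eqF// scale1r /G.
  by rewrite [RHS]addrC addrA subrK.
rewrite /objective !(L2normBE oO)// !(L2normE oO)// uhE Gd [t *: mk h + _]addrC.
exact: tracking_quotient.
Unshelve. all: by end_near. Qed.

End objective.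

(** At [k = 0] the expression is quadratic in [tau] with negative slope [a0], and [tau = - a0 / D]
    makes [C2 * (tau * n0) ^+ 2] at most [- tau * a0 / 2]. As [k <= 1] implies [k ^+ 2 <= k], the
    terms in [k] add at most [k * B <= - tau * a0 / 4], so the total stays below [tau * a0 / 4]. *)
Lemma descent_parameters (R : realFieldType) (a0 C2 n0 S M : R) :
  a0 < 0 -> 0 < C2 -> 0 <= n0 -> 0 <= S -> 0 <= M ->
  exists2 tau : R, 0 < tau & exists2 k0 : R, 0 < k0 &
    forall k, 0 <= k -> k <= k0 ->
    2^-1 * (C2 * (tau * n0 + k * S) ^+ 2) + tau * a0 + k * M < 0.
Proof.
move=> a0_lt0 C20 n00 S0 M0.
pose D := 2 * (C2 * n0 ^+ 2 + 1).
have D0 : 0 < D by rewrite /D mulr_gt0// ltr_wpDl// mulr_ge0 ?sqr_ge0 ?ltW.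
pose tau := - a0 / D; have tau0 : 0 < tau by rewrite divr_gt0 ?oppr_gt0.
have tauD : tau * D = - a0 by rewrite /tau mulfVK// gt_eqF.
pose B := C2 * S ^+ 2 + M + 1.
have B0 : 0 < B by rewrite ltr_wpDl// addr_ge0// mulr_ge0 ?sqr_ge0 ?ltW.
exists tau => //; exists (Num.min 1 (- (tau * a0) / 4 / B)).
  by rewrite lt_min ltr01 !divr_gt0// oppr_gt0 pmulr_rlt0.
move=> k k_ge0; rewrite le_min => /andP[k1]; rewrite ler_pdivlMr// => kB.
have kk : k ^+ 2 <= k by rewrite expr2 ler_piMr.
have h1 : (tau * n0 + k * S) ^+ 2 <= 2 * (tau * n0) ^+ 2 + 2 * (k * S) ^+ 2.
  by have := sqr_ge0 (tau * n0 - k * S); lra.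
have h2 : C2 * (k * S) ^+ 2 <= k * (C2 * S ^+ 2).
  rewrite exprMn mulrCA; apply: ler_wpM2r => //.
  by rewrite mulr_ge0 ?sqr_ge0 ?ltW.
have h3 : C2 * (tau * n0) ^+ 2 <= - (tau * a0) / 2.
  rewrite -mulrN -tauD /D exprMn.
  have : 0 <= tau * tau by rewrite mulr_ge0 ?ltW.
  by lra.
have h4 := ler_wpM2l (ltW C20) h1.
have ta : tau * a0 < 0 by rewrite pmulr_rlt0.
by move: kB; rewrite /B; lra.
Qed.

(* [(h, d)] is the optimal pair and [z] belongs to [h] in the linearized equation;
   [(h', z')] is the competitor, close to [tau] times [(h0, z0)]; [g_] and [u_]
   are inner products with [S(u) - g] and [u]. *)
Lemma descent_estimate (R : realFieldType)
    (alpha C2 tau k n0 S T nG nU qh qh' gd uh gz' uh' gz0 uh0 gz : R) :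
  2^-1 * qh + gd + alpha * uh <= 2^-1 * qh' + gz' + alpha * uh' ->
  0 <= qh -> qh' <= C2 * (tau * n0 + k * (2 * S)) ^+ 2 ->
  gz' - tau * gz0 <= nG * (T * (k * S)) ->
  alpha * (uh' - tau * uh0) <= alpha * (nU * (k * (2 * S))) ->
  gz - gd <= nG * (T * (k * S)) ->
  gz + alpha * uh <= 2^-1 * (C2 * (tau * n0 + k * (2 * S)) ^+ 2) +
    tau * (gz0 + alpha * uh0) + k * (2 * (nG * (T * S)) + alpha * (nU * (2 * S))).
Proof.
move: (C2 * _) => Q opt q0 q' e1 e2 e3.
suff : k * (2 * (nG * (T * S)) + alpha * (nU * (2 * S))) =
  2 * (nG * (T * (k * S))) + alpha * (nU * (k * (2 * S))) by lra.
by ring.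
Qed.

(** * L^p on a bounded open set *)

Section Lp.
Context {R : realType} {n : nat}.
Local Notation m := n.+1.
Variable Omega : set 'rV[R]_m.
Hypotheses (oO : open Omega) (bO : bounded_set Omega).
Local Notation mu := (lebesgue_rV R m).
Local Notation in_L2 := (in_Lp Omega 2%:E).
Let mO : measurable Omega. Proof. exact: open_measurable_rV. Qed.
Implicit Types f g : 'rV[R]_m -> R.

Lemma in_Lp_lin (p a : R) f g : 1 <= p -> in_Lp Omega p%:E f ->
  in_Lp Omega p%:E g -> in_Lp Omega p%:E (fun x => a * f x + g x).
Proof.
move=> p1 fp gp; have p1' : (1 <= p%:E)%E by rewrite lee_fin.
have [_ H] := Lfun_submod_closed mu p1'; rewrite /in_Lp.
rewrite (_ : _ \_ _ = a *: (f \_ Omega : 'rV[R]_m -> R) + (g \_ Omega)); first exact: H.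
apply/funext => x; rewrite -[RHS]/(a * (f \_ Omega) x + (g \_ Omega) x) !patchE.
by case: ifPn => // _; rewrite mulr0 addr0.
Qed.

Lemma in_Lp_bounded (p B : R) f : 1 <= p -> measurable_fun setT (f \_ Omega) ->
  (forall x, Omega x -> `|f x| <= B) -> in_Lp Omega p%:E f.
Proof.
move=> p1 mf fB; rewrite /in_Lp inE; apply/andP; split; rewrite inE//=.
have H : (\int[mu]_x ((`|(f \_ Omega) x| `^ p)%:E) < +oo)%E.
  apply: (@le_lt_trans _ _ (\int[mu]_(x in Omega) ((`|B| `^ p)%:E))%E).
    rewrite [leRHS]integral_mkcond; apply: ge0_le_integral => //.
    - by apply/measurable_EFinP; apply: (measurableT_comp (measurable_powR p));
        apply: measurableT_comp.
    - by apply/(measurable_restrictT _ mO); exact: measurable_cst.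
    - move=> x _; rewrite !patchE; case: ifPn => xO.
        rewrite lee_fin ge0_ler_powR// ?nnegrE//; first by lra.
        exact: le_trans (fB _ (set_mem xO)) (ler_norm B).
      by rewrite normr0 powR0// gt_eqF//; lra.
  rewrite integral_cst// lte_mul_pinfty ?lee_fin ?powR_ge0//.
  exact: bounded_measure_lty.
by rewrite /finite_norm unlock poweR_lty.
Qed.

Lemma in_Lp_in_L2 (p : R) f : 2 <= p -> in_Lp Omega p%:E f -> in_L2 f.
Proof.
move=> p2 fp; have p1 : 1 <= p by lra.
apply: in_L2P; first exact: in_L2_measurable fp.
have /integrableP[mp ip] := Lfun_integrable p1 fp.
apply: (@le_lt_trans _ _ (\int[mu]_(x in Omega) (1%:E + (`|(f \_ Omega) x| `^ p)%:E))%E).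
  apply: ge0_le_integral => //.
  - by move=> x _; rewrite lee_fin sqr_ge0.
  - apply/measurable_EFinP; apply: measurable_funX.
    by apply/(measurable_restrictT _ mO); exact: in_L2_measurable fp.
  - by apply: emeasurable_funD => //; exact: measurable_funS mp.
  move=> x Ox; rewrite -EFinD lee_fin patchE mem_set//.
  rewrite -[leLHS]real_normK ?num_real// -powR_mulrn//.
  have [f1|f1] := leP `|f x| 1.
    have : `|f x| `^ 2%:R <= 1 by rewrite powR_mulrn// expr_le1.
    by have := powR_ge0 `|f x| p; lra.
  have : `|f x| `^ 2%:R <= `|f x| `^ p by rewrite ler_powR// ltW.
  by lra.
rewrite ge0_integralD//; last exact: measurable_funS mp.
apply: lte_add_pinfty.
  by rewrite integral_cst// mul1e; exact: bounded_measure_lty.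
apply: le_lt_trans ip; apply: (@le_trans _ _ (\int[mu]_x (`|(f \_ Omega) x| `^ p)%:E)%E).
  by apply: ge0_subset_integral => // x _; rewrite lee_fin powR_ge0.
rewrite le_eqVlt; apply/orP; left; apply/eqP/eq_integral => x _.
by rewrite gee0_abs// lee_fin powR_ge0.
Qed.

End Lp.

(** * The subproblem *)

Section descent.
Context {R : realType} {n : nat}.
Local Notation m := n.+1.
Variable Omega : set 'rV[R]_m.
Hypotheses (oO : open Omega) (bO : bounded_set Omega).
Variable N : relu_net R m 1.
Hypothesis N_homo : forall x, {homo (fun y => net_eval N x y 0 0) : y1 y2 / y1 <= y2}.
Implicit Types f g h u v d : 'rV[R]_m -> R.

Local Notation mu := (lebesgue_rV R m).
Local Notation in_L2 := (in_Lp Omega 2%:E).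
Let mO : measurable Omega. Proof. exact: open_measurable_rV. Qed.

Local Notation L2 := (LfunType mu (@le1_2 R)).
Local Notation ip := (@l2ip R _ _ mu Omega).
Local Notation nrm := (ipnorm ip).
Local Notation ipY := (sum_ip ip).
Local Notation mk := (l2_class Omega).
Local Notation poisson := (weak_poisson ip ipY (@test_pair R n Omega)).
Let ipP : semi_inner ip := l2ip_semi_inner mu mO.
Let ipYP : semi_inner (ipY : ('I_m -> L2) -> _) := sum_ip_semi_inner _ ipP.
Local Notation state := (state Omega N).
Local Notation dsuper u := (superposeL2 Omega (net_dfun N relu (state u))).
Local Notation S := (nrm (mk (fun=> 1))).

(** [S], the norm of the constant 1, is the square root of the measure of [Omega]; it turns
    pointwise errors into errors in L^2. *)
Lemma l2norm_bounded (k : R) f : in_L2 f -> 0 <= k ->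
  (forall x, Omega x -> `|f x| <= k) -> nrm (mk f) <= k * S.
Proof.
move=> f2 k0 fk; apply: (l2norm_le oO) => // x Ox.
have c2 : in_L2 (fun=> 1).
  apply: (in_L2_bounded oO bO (B := 1)) => [|y _]; last by rewrite normr1.
  by apply/(measurable_restrictT _ mO).
by rewrite !l2_class_in// normr1 mulr1 fk.
Qed.

(** Keeps [v] and changes the control. A solution of the linearized equation thereby becomes one of
    the smoothed equation. *)
Lemma weak_solution_shift F F' f v : in_L2 f -> in_L2 (F v) -> in_L2 (F' v) ->
  weak_solution Omega F f v ->
  weak_solution Omega F' (fun x => f x + (F' v x - F v x)) v.
Proof.
move=> f2 F2 F2' [w vw eqw]; exists w => // phi tphi.
have phi2 := test_function_in_L2 oO bO tphi.
have d2 := in_L2B F2' F2.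
have [fd2 fdE] := l2_class_lin 1 f2 d2.
have E : (fun x => f x + (F' v x - F v x)) = (fun x => 1 * f x + (F' v \- F v) x).
  by apply/funext => x; rewrite mul1r.
rewrite -[in RHS](l2ip_class (f := fun x => f x + _)) ?E// fdE l2_classB//.
rewrite scale1r (ipDl ipP) (ipBl ipP) !l2ip_class// -(eqw _ tphi).
by ring.
Qed.

Section linearized.
Variables (u : 'rV[R]_m -> R).
Hypothesis u2 : in_L2 u.

Lemma superpose_deriv_in_L2 v : in_L2 v -> in_L2 (superpose_deriv relu N (state u) v).
Proof.
have [K K0 [_ nD]] := net_nemytskii oO bO N_homo.
have [y2 _] := state_poisson oO bO N_homo u2.
exact: (nemytskii_in_L2 oO bO (nD _ (in_L2_measurable y2))).
Qed.

Lemma linearized_exists h : in_L2 h -> exists z, in_L2 z /\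
  weak_solution Omega (superpose_deriv relu N (state u)) h z.
Proof.
move=> h2; have [K K0 [_ nD]] := net_nemytskii oO bO N_homo.
have [y2 _] := state_poisson oO bO N_homo u2.
have [z zP] := superpose_weak_solution_exists oO bO K0 (nD _ (in_L2_measurable y2)) h2.
by exists z; split => //; exact: in_L2_coe.
Qed.

Lemma linearized_poisson h z : in_L2 h ->
  weak_solution Omega (superpose_deriv relu N (state u)) h z -> in_L2 z ->
  exists w, poisson (mk h - dsuper u (mk z)) (mk z) w.
Proof.
move=> h2 hz z2.
have [_] := weak_solution_poisson oO bO h2 hz (superpose_deriv_in_L2 z2).
by rewrite superposeL2_class.
Qed.

Lemma linearized_monotone : ip_monotone ip (dsuper u).
Proof.
have [K K0 [_ nD]] := net_nemytskii oO bO N_homo.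
have [y2 _] := state_poisson oO bO N_homo u2.
exact: (superposeL2_monotone oO bO (nD _ (in_L2_measurable y2))).
Qed.

Lemma linearizedE (v : L2) x : dsuper u v x =
  if x \in Omega then net_dfun N relu (state u) x (v x) else 0.
Proof.
have [K K0 [_ nD]] := net_nemytskii oO bO N_homo.
have [y2 _] := state_poisson oO bO N_homo u2.
rewrite /superposeL2 l2_classE ?patchE//.
by apply: (nemytskii_in_L2 oO bO (nD _ (in_L2_measurable y2))); exact: in_L2_coe.
Qed.

(** A directional derivative at a kink is only positively homogeneous, hence [0 < c]. *)
Lemma linearizedZ (c : R) (v : L2) : 0 < c -> dsuper u (c *: v) = c *: dsuper u v.
Proof.
move=> c0; apply/LfuneqP => x; rewrite -[RHS]/(c * dsuper u v x) !linearizedE.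
by case: ifPn => _; rewrite ?mulr0// net_dfun_scale.
Qed.

Lemma linearized0 : dsuper u 0 = 0.
Proof.
apply/LfuneqP => x; rewrite linearizedE.
by case: ifPn => // _; rewrite -[(0 : L2) x]/(0 : R) net_dfun0.
Qed.

Section smoothed.
Variables (s : R -> R) (k : R).
Hypotheses (ms : measurable_fun setT s) (k0 : 0 <= k).
Hypothesis sk : forall x y (t : R),
  `|net_deriv s N x y t 0 0 - net_deriv relu N x y t 0 0| <= k.

Lemma smoothed_diff v : in_L2 v ->
  [/\ in_L2 (superpose_deriv s N (state u) v),
      measurable_fun setT ((fun x => superpose_deriv s N (state u) v x -
         superpose_deriv relu N (state u) v x) \_ Omega) &
      nrm (mk (superpose_deriv s N (state u) v) -
         mk (superpose_deriv relu N (state u) v)) <= k * S].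
Proof.
move=> v2; have [y2 _] := state_poisson oO bO N_homo u2.
have my := in_L2_measurable y2; have mv := in_L2_measurable v2.
have r2 := superpose_deriv_in_L2 v2.
have mS : measurable_fun setT (superpose_deriv s N (state u) v \_ Omega).
  rewrite (_ : _ \_ _ = superpose_deriv s N (state u \_ Omega) (v \_ Omega) \_ Omega).
    apply/(measurable_restrictT _ mO); apply: measurable_funS
      (measurable_net_deriv N 0 ms my mv) => //.
  apply/funext => x; rewrite !patchE /superpose_deriv; case: ifPn => // xO.
  by rewrite !patchE xO.
have mD : measurable_fun setT ((fun x => superpose_deriv s N (state u) v x -
         superpose_deriv relu N (state u) v x) \_ Omega).
  apply/(measurable_restrictT _ mO); apply: measurable_funB;
    apply/(measurable_restrictT _ mO) => //; exact: in_L2_measurable r2.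
have d2 : in_L2 (superpose_deriv s N (state u) v \- superpose_deriv relu N (state u) v).
  by apply: (in_L2_bounded oO bO (B := k)) => // x _; exact: sk.
have s2 : in_L2 (superpose_deriv s N (state u) v).
  have := (l2_class_lin 1 d2 r2).1; congr (in_Lp _ _ _); apply/funext => x /=.
  by ring.
split => //; rewrite -l2_classB//; apply: l2norm_bounded => // x _; exact: sk.
Qed.

(** [d] solves the linearized equation with control [h - (Ds - Dr)], where [Ds] and [Dr] are the two
    derivative terms at [d]; stability of that equation compares it with [z]. It holds for every
    solution [d] of the smoothed equation. *)
Lemma smoothed_close h d z : in_L2 h -> in_L2 d -> in_L2 z ->
  weak_solution Omega (superpose_deriv s N (state u)) h d ->
  weak_solution Omega (superpose_deriv relu N (state u)) h z ->
  forall C, 0 < C -> (forall x y, test_pair Omega x y ->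
    nrm x <= C * ipnorm ipY y) ->
  nrm (mk d - mk z) <= C ^+ 2 * (k * S).
Proof.
move=> h2 d2 z2 hd hz C C0 CP.
have [s2 _ close] := smoothed_diff d2.
have [_ [wd dP]] := weak_solution_poisson oO bO h2 hd s2.
have [wz zP] := linearized_poisson h2 hz z2.
set Ds := mk (superpose_deriv s _ _ _) in dP close.
set Dr := mk (superpose_deriv relu _ _ _) in close.
have dP' : poisson ((mk h - (Ds - Dr)) - dsuper u (mk d)) (mk d) wd.
  rewrite superposeL2_class// -/Dr (_ : mk h - (Ds - Dr) - _ = mk h - Ds)//.
  by rewrite opprB addrA addrAC addrK.
have := poisson_stable ipP ipYP (test_pair_lin oO bO) C0 CP linearized_monotone dP' zP.
move=> /le_trans; apply; rewrite ler_wpM2l ?sqr_ge0//.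
by rewrite [_ - _ - mk h]addrAC subrr add0r ipnormN.
Qed.

End smoothed.
End linearized.
End descent.

(** * The competitor and the descent property *)

Section descent_direction_section.
Context {R : realType} {n : nat}.
Local Notation m := n.+1.
Variable Omega : set 'rV[R]_m.
Hypotheses (oO : open Omega) (bO : bounded_set Omega).
Variable N : relu_net R m 1.
Hypothesis N_homo : forall x, {homo (fun y => net_eval N x y 0 0) : y1 y2 / y1 <= y2}.
Variables (ua ub : 'rV[R]_m -> R) (p : R).
Hypothesis p2 : 2 <= p.
Hypotheses (ua_oo : in_Lp Omega +oo%E ua) (ub_oo : in_Lp Omega +oo%E ub).
Hypothesis uaub : ae_in Omega (fun x => ua x < ub x).
Implicit Types f g h u v d : 'rV[R]_m -> R.

Local Notation mu := (lebesgue_rV R m).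
Local Notation in_L2 := (in_Lp Omega 2%:E).
Let mO : measurable Omega. Proof. exact: open_measurable_rV. Qed.

Local Notation L2 := (LfunType mu (@le1_2 R)).
Local Notation ip := (@l2ip R _ _ mu Omega).
Local Notation nrm := (ipnorm ip).
Local Notation ipY := (sum_ip ip).
Local Notation mk := (l2_class Omega).
Local Notation poisson := (weak_poisson ip ipY (@test_pair R n Omega)).
Let ipP : semi_inner ip := l2ip_semi_inner mu mO.
Let ipYP : semi_inner (ipY : ('I_m -> L2) -> _) := sum_ip_semi_inner _ ipP.
Local Notation state := (state Omega N).
Local Notation dsuper u := (superposeL2 Omega (net_dfun N relu (state u))).
Local Notation S := (nrm (mk (fun=> 1))).

Lemma measurable_active u v : measurable_fun setT (u \_ Omega) ->
  measurable_fun setT (v \_ Omega) ->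
  measurable_fun setT ((fun x => (u x == v x)%:R : R) \_ Omega).
Proof.
move=> mu' mv.
have := measurableT_comp (@measurable_eq0 R) (measurable_funB mu' mv).
move=> /(measurable_funS measurableT (@subsetT _ Omega)).
move=> /(measurable_restrictT _ mO).
congr (measurable_fun _ _); apply/funext => x; rewrite !patchE.
by case: ifPn => // xO; rewrite /= !patchE xO subr_eq0.
Qed.

(* The correction [k (1_{u = ua} - 1_{u = ub})] of the right-hand side absorbs
   the pointwise error of size [k] between the two superposition operators, so
   that [h'] stays in the contingent cone. Solving the smoothed equation for a
   prescribed [h'] would need more, as [s] need not make it monotone. *)
Lemma feasible_competitor u h0 z0 (s : R -> R) (k tau C : R) :
  in_Lp Omega p%:E u -> contingent_cone Omega ua ub p u h0 ->
  measurable_fun setT s -> 0 <= k ->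
  (forall x y t, `|net_deriv s N x y t 0 0 - net_deriv relu N x y t 0 0| <= k) ->
  0 < tau -> 0 < C ->
  (forall x y, test_pair Omega x y -> nrm x <= C * ipnorm ipY y) ->
  in_L2 z0 -> weak_solution Omega (superpose_deriv relu N (state u)) h0 z0 ->
  exists h' z', [/\ subproblem_feasible Omega N ua ub p s u h' z', in_L2 z',
    nrm (mk h' - tau *: mk h0) <= k * (2 * S) &
    nrm (mk z' - tau *: mk z0) <= C ^+ 2 * (k * S)].
Proof.
move=> up [h0p h0a h0b] ms k0 sk tau0 C0 CP z02 h0z0.
have p1 : 1 <= p by apply: le_trans p2; rewrite ler1n.
have u2 := in_Lp_in_L2 oO bO p2 up.
have h02 := in_Lp_in_L2 oO bO p2 h0p.
have mu' := in_L2_measurable up.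
pose a x : R := (u x == ua x)%:R; pose b x : R := (u x == ub x)%:R.
have ma : measurable_fun setT (a \_ Omega).
  exact: measurable_active mu' (in_L2_measurable ua_oo).
have mb : measurable_fun setT (b \_ Omega).
  exact: measurable_active mu' (in_L2_measurable ub_oo).
pose chi x := k * (a x - b x).
have chiB x : `|chi x| <= k.
  rewrite /chi /a /b normrM (ger0_norm k0) ler_piMr//.
  by case: eqP => _; case: eqP => _; rewrite ?subrr ?subr0 ?sub0r ?normrN ?normr1 ?normr0.
have mchi : measurable_fun setT (chi \_ Omega).
  apply/(measurable_restrictT _ mO); apply: measurable_funM => //.
  by apply: measurable_funB; apply/(measurable_restrictT _ mO).
have chip : in_Lp Omega p%:E chi.
  by apply: (in_Lp_bounded oO bO (B := k)) => // x _; exact: chiB.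
have chi2 := in_Lp_in_L2 oO bO p2 chip.
have [f2 fE] := l2_class_lin tau h02 chi2.
set f := (fun x => tau * h0 x + chi x) in f2 fE.
have fp : in_Lp Omega p%:E f := in_Lp_lin tau p1 h0p chip.
have [z' [z'2 fz']] := linearized_exists oO bO N_homo u2 f2.
have [s2 mD closeD] := smoothed_diff oO bO N_homo u2 ms k0 sk z'2.
have r2 := superpose_deriv_in_L2 oO bO N_homo u2 z'2.
pose D x := superpose_deriv s N (state u) z' x - superpose_deriv relu N (state u) z' x.
have DB x : `|D x| <= k by exact: sk.
have Dp : in_Lp Omega p%:E D by apply: (in_Lp_bounded oO bO (B := k)).
have D2 := in_Lp_in_L2 oO bO p2 Dp.
pose h' x := f x + D x.
have h'E : h' = (fun x => 1 * f x + D x) by apply/funext => x; rewrite mul1r.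
have [h'2 mkh'] := l2_class_lin 1 f2 D2; rewrite -h'E in h'2 mkh'.
have h'p : in_Lp Omega p%:E h' by rewrite h'E; exact: in_Lp_lin.
have chiS := l2norm_bounded oO bO chi2 k0 (fun x _ => chiB x).
have DS := l2norm_bounded oO bO D2 k0 (fun x _ => DB x).
exists h', z'; split => //.
- split => //; first exact: (weak_solution_shift oO bO f2 r2 s2 fz').
  split => //.
  (* Where [u = ua], almost everywhere [u < ub], so [chi] is exactly [k] and outweighs [D >= - k];
     the case [u = ub] is symmetric. *)
  + move: h0a uaub; rewrite /ae_in; apply: filterS2 => x h0x uabx Ox ux.
    have /h0x/(_ ux) h0x0 := Ox; have := uabx Ox; rewrite -ux => ub'.
    rewrite /h' /f /chi /a /b ux eqxx lt_eqF// -?ux//= subr0 mulr1.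
    have := DB x; rewrite ler_norml => /andP[+ _].
    by have : 0 <= tau * h0 x by [rewrite mulr_ge0// ltW]; lra.
  + move: h0b uaub; rewrite /ae_in; apply: filterS2 => x h0x uabx Ox ux.
    have /h0x/(_ ux) h0x0 := Ox; have := uabx Ox; rewrite -ux => ua'.
    rewrite /h' /f /chi /a /b ux eqxx gt_eqF// -?ux//= sub0r mulrN1.
    have := DB x; rewrite ler_norml => /andP[_].
    by have : tau * h0 x <= 0 by [rewrite mulr_ge0_le0// ltW]; lra.
(* [h'] deviates from [tau *: h0] by [chi] and by [D], each of norm at most [k * S]. The state [z']
   belongs to the control [f], which contains only [chi], hence the single [k * S] in its bound. *)
- rewrite mkh' scale1r fE addrAC [_ + mk chi]addrC addrK.
  rewrite mulrCA [leRHS]mulr_natl [leRHS]mulr2n.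
  by apply: le_trans (ipnormD ipP _ _) _; exact: lerD.
have [w' z'P] := linearized_poisson oO bO N_homo u2 f2 fz' z'2.
have [w0 z0P] := linearized_poisson oO bO N_homo u2 h02 h0z0 z02.
have := weak_poissonZ ipP ipYP (test_pair_lin oO bO) tau z0P.
rewrite scalerBr -(linearizedZ oO bO N_homo u2 _ tau0) => tz0P.
have := poisson_stable ipP ipYP (test_pair_lin oO bO) C0 CP
  (linearized_monotone oO bO N_homo u2) z'P tz0P.
move=> /le_trans; apply; rewrite ler_wpM2l ?sqr_ge0//.
by rewrite fE addrC addKr.
Qed.

Lemma descent_direction g (alpha : R)
    (q : ('rV[R]_m -> R) -> ('rV[R]_m -> R) -> R) (sig : R -> R -> R) u :
  in_L2 g -> 0 < alpha -> is_q Omega q -> canonical_smoothing sig ->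
  admissible Omega ua ub p u ->
  ~ B_stationary Omega N g ua ub alpha p u ->
  exists2 eps_star : R, 0 < eps_star &
    forall eps : R, 0 < eps -> eps < eps_star ->
    forall h, subproblem_solution Omega N g ua ub alpha p q (sig eps) u h ->
      objective_deriv Omega N g alpha u h < 0 /\
      ~ ae_in Omega (fun x => h x = 0).
Proof.
move=> g2 a0 qP sigP adm nB; have up := adm.1.
have u2 := in_Lp_in_L2 oO bO p2 up.
have [h0 h0c h0lt] : exists2 h0, contingent_cone Omega ua ub p u h0 &
    objective_deriv Omega N g alpha u h0 < 0.
  apply: contrapT => H; apply: nB; split => // h hc.
  by rewrite leNgt; apply/negP => hlt; apply: H; exists h.
have h02 : in_L2 h0 by case: h0c => h0p _ _; exact: (in_Lp_in_L2 oO bO p2).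
have [y2 _] := state_poisson oO bO N_homo u2.
have [z0 [z02 h0z0]] := linearized_exists oO bO N_homo u2 h02.
have [C C0 CP] := test_pair_poincare oO bO.
set G := mk (state u) - mk g; set U := mk u.
have J h z : in_L2 h -> in_L2 z ->
    weak_solution Omega (superpose_deriv relu N (state u)) h z ->
    objective_deriv Omega N g alpha u h = ip G (mk z) + alpha * ip U (mk h).
  move=> h2 z2 hz.
  have [w] := linearized_poisson oO bO N_homo u2 h2 hz z2.
  rewrite superposeL2_class//; exact: objective_deriv_cvg.
have J0 := J _ _ h02 z02 h0z0; rewrite J0 in h0lt.
have [c c0 rate] := smoothing_rate sigP.
have [Cn Cn0 CnP] := net_deriv_smoothing N.
have [C1 C10 qge] := q_coercive qP.
have [C2 C20 qle] := q_bounded qP.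
have S0 : 0 <= S by exact: ipnorm_ge0.
have nG0 : 0 <= nrm G by exact: ipnorm_ge0.
have nU0 : 0 <= nrm U by exact: ipnorm_ge0.
have CS0 : 0 <= C ^+ 2 * S by rewrite mulr_ge0 ?sqr_ge0.
have M0 : 0 <= 2 * (nrm G * (C ^+ 2 * S)) + alpha * (nrm U * (2 * S)).
  apply: addr_ge0; first by rewrite mulr_ge0// mulr_ge0.
  by rewrite mulr_ge0 ?(ltW a0)// mulr_ge0// mulr_ge0.
have [tau tau0 [k0 k00 param]] := descent_parameters h0lt C20
  (ipnorm_ge0 ip (mk h0)) (mulr_ge0 (ler0n R 2) S0) M0.
(* The derivative error is [k = Cn * (c * eps)], which this makes at most [k0]; the added 1 covers
   [Cn = 0]. *)
exists (k0 / (Cn * c + 1)).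
  by rewrite divr_gt0// ltr_wpDl// mulr_ge0// ltW.
move=> eps eps0; rewrite ltr_pdivlMr ?ltr_wpDl ?mulr_ge0 ?(ltW c0)// => epsk h.
pose k := Cn * (c * eps).
have ceps0 : 0 <= c * eps by rewrite mulr_ge0 ?ltW.
have k_ge0 : 0 <= k by rewrite mulr_ge0.
have kk0 : k <= k0 by rewrite /k mulrA; lra.
have ms : measurable_fun setT (sig eps).
  apply: continuous_measurable_fun => t; apply/differentiable_continuous.
  by apply/derivable1_diffP; exact: (smoothing_derivable sigP).
have sk x y t : `|net_deriv (sig eps) N x y t 0 0 - net_deriv relu N x y t 0 0| <= k.
  by apply: CnP => // r; exact: rate.
have [h' [z' [feas' z'2 hclose zclose]]] :=
  feasible_competitor up h0c ms k_ge0 sk tau0 C0 CP z02 h0z0.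
move=> [d [[h2 hd hcone] hmin]].
have d2 : in_L2 d by case: hd => ? [].
have [z [z2 hz]] := linearized_exists oO bO N_homo u2 h2.
have dclose := smoothed_close oO bO N_homo u2 ms k_ge0 sk h2 d2 z2 hd hz C0 CP.
have := hmin _ _ feas'; rewrite /subproblem_objective.
have h'2 : in_L2 h' by case: feas'.
have yg2 := in_L2B y2 g2.
rewrite -!l2ip_class// l2_classB// -/G -/U => opt.
have Jlt : objective_deriv Omega N g alpha u h < 0.
  rewrite (J _ _ h2 z2 hz); apply: le_lt_trans (param k k_ge0 kk0).
  have q0 : 0 <= q h h.
    by apply: le_trans (qge h h2); rewrite mulr_ge0 ?sqr_ge0 ?ltW.
  have nh' : nrm (mk h') <= tau * nrm (mk h0) + k * (2 * S).
    have := ipnormD ipP (tau *: mk h0) (mk h' - tau *: mk h0).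
    rewrite addrC subrK ipnormZ// (gtr0_norm tau0) => /le_trans; apply.
    by rewrite lerD2l.
  have q' : q h' h' <= C2 * (tau * nrm (mk h0) + k * (2 * S)) ^+ 2.
    apply: le_trans (qle _ _ h'2 h'2) _; rewrite (L2normE oO)// -mulrA -expr2.
    rewrite ler_wpM2l ?(ltW C20)//.
    by rewrite ler_pXn2r// nnegrE ?ipnorm_ge0// (le_trans (ipnorm_ge0 _ (mk h')) nh').
  have e1 := ip_le ipP G (mk z' - tau *: mk z0).
  have e1' := ler_wpM2l nG0 zclose.
  have e2 := ip_le ipP U (mk h' - tau *: mk h0).
  have e2' := ler_wpM2l nU0 hclose.
  have e3 := ip_le ipP G (mk z - mk d).
  rewrite (ipnorm_distC ipP (mk z)) in e3.
  have e3' := ler_wpM2l nG0 dclose.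
  move: e1 e2 e3; rewrite !(ipBr ipP) !(ipZr ipP) => e1 e2 e3.
  have e2a : alpha * (ip U (mk h') - tau * ip U (mk h0)) <=
      alpha * (nrm U * (k * (2 * S))).
    by rewrite ler_pM2l//; exact: le_trans e2 e2'.
  exact: (descent_estimate opt q0 q' (le_trans e1 e1') e2a (le_trans e3 e3')).
(* If [h] vanished almost everywhere, stability against the zero solution would give [z] norm zero,
   so the derivative would be 0, against [Jlt]. *)
split => // hae; move: Jlt; rewrite (J _ _ h2 z2 hz).
have h0' (w : L2) : ip (mk h) w = 0.
  rewrite -(ip0l ipP w); apply: (l2ip_ae_eq oO); move: hae; rewrite /ae_in.
  by apply: filterS => x hx Ox; rewrite l2_class_in// hx.
have nh0 : nrm (mk h) = 0 by rewrite /ipnorm h0' sqrtr0.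
have [w zP] := linearized_poisson oO bO N_homo u2 h2 hz z2.
have zP0 : poisson (0 - dsuper u 0) 0 0.
  have := weak_poissonB ipP ipYP (test_pair_lin oO bO) zP zP.
  by rewrite !subrr (linearized0 oO bO N_homo u2) subr0.
have := poisson_stable ipP ipYP (test_pair_lin oO bO) C0 CP
  (linearized_monotone oO bO N_homo u2) zP zP0.
rewrite !subr0 nh0 mulr0 => nz.
have nz0 : nrm (mk z) = 0 by apply/eqP; rewrite eq_le nz ipnorm_ge0.
rewrite (ipC ipP G) (ipnorm_eq0 ipP G nz0) (ipC ipP U) h0' mulr0 addr0.
by rewrite ltxx.
Qed.

End descent_direction_section.

Theorem proposition4p8 (R : realType) (m : nat) (Omega : set 'rV[R]_m)
    (N : relu_net R m 1) (g ua ub : 'rV[R]_m -> R) (alpha p : R)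
    (q : ('rV[R]_m -> R) -> ('rV[R]_m -> R) -> R) (sig : R -> R -> R)
    (u : 'rV[R]_m -> R) :
  (2 <= m)%N ->
  open Omega -> bounded_set Omega -> lipschitz_boundary Omega ->
  in_Lp Omega 2%:E g -> 0 < alpha ->
  2 <= p -> m%:R / 2 < p ->
  in_Lp Omega +oo%E ua -> in_Lp Omega +oo%E ub ->
  ae_in Omega (fun x => ua x < ub x) ->
  (forall x, {homo (fun y => net_eval N x y 0 0) : y1 y2 / y1 <= y2}) ->
  is_q Omega q -> canonical_smoothing sig ->
  admissible Omega ua ub p u ->
  ~ B_stationary Omega N g ua ub alpha p u ->
  exists2 eps_star : R, 0 < eps_star &
    forall eps : R, 0 < eps -> eps < eps_star ->
    forall h, subproblem_solution Omega N g ua ub alpha p q (sig eps) u h ->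
      objective_deriv Omega N g alpha u h < 0 /\
      ~ ae_in Omega (fun x => h x = 0).
Proof.
(* Writing the dimension as [n.+1] provides the first axis along which the Poincare inequality is
   proved. *)
case: m Omega N g ua ub q u => [//|n] Omega N g ua ub q u _ oO bO _ g2 alpha0 p2 _.
move=> ua_oo ub_oo uaub N_homo qP sigP adm nB.
exact: (descent_direction oO bO N_homo p2 ua_oo ub_oo uaub g2 alpha0 qP sigP adm nB).
Qed.
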